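(* Let $0<\varepsilon\le1$, $0<\mu\le1$ and $C>0$ be constants. Let $A=(a_{ij})$ be an $n\times n$ real matrix and let $x_1,\dots,x_n,y_1,\dots,y_n$ be independent copies of $\eta^{\mu}$. Assume $$\rho_b^{(\mu)}(A):=\sup_{a\in\mathbb{R}}\mathbb{P}\Big(\sum_{i,j}a_{ij}x_iy_j=a\Big)\ge n^{-C}.$$ Then there exist a set $I_0$ of size $O_{C,\varepsilon,\mu}(1)$, a set $I$ of size $n-3n^{\varepsilon}$ with $I\cap I_0=\emptyset$, and a nonzero integer $k$ with $|k|\le n^{O_{C,\varepsilon,\mu}(1)}$, such that for every $i\in I$ there exist a proper symmetric GAP $Q_i$ of rank $O_{C,\varepsilon,\mu}(1)$ and size $n^{O_{C,\varepsilon,\mu}(1)}$, an index set $J_i$ of size $n-n^{\varepsilon}$, and integers $k_{ii_0}$, $i_0\in I_0$, all of absolute value at most $n^{O_{C,\varepsilon,\mu}(1)}$, such that for all $j\in J_i$ $$\sum_{i_0\in I_0}k_{ii_0}a_{i_0j}+k\,a_{ij}\in Q_i.$$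
   Context: For $0<\mu\le1$, $\eta^{\mu}$ takes values $1$ and $-1$ with probability $\mu/2$ each and $0$ with probability $1-\mu$. A symmetric GAP of rank $r$ is $\{m_1g_1+\dots+m_rg_r: m_h\in\mathbb{Z}, |m_h|\le N_h\}$ with real $g_h$, nonnegative integers $N_h$; proper means unique representation; size means cardinality. $O_{C,\varepsilon,\mu}(1)$ denotes a quantity bounded by a constant depending only on $C,\varepsilon,\mu$; asymptotics are as $n\to\infty$. *)

(* Defs.v *)
From HB Require Import structures.
From mathcomp Require Export all_boot all_order all_algebra.
From mathcomp Require Export all_classical all_reals all_analysis.

Set Implicit Arguments.
Unset Strict Implicit.
Unset Printing Implicit Defensive.

Export Order.TTheory GRing.Theory Num.Theory.
Export numFieldNormedType.Exports.

Local Open Scope classical_set_scope.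
Local Open Scope ring_scope.

(* X is a copy of eta^mu; the three probabilities add up to 1, so these
   equations determine the law of X. *)
Definition is_eta (R : realType) (d : measure_display) (T : measurableType d)
    (P : probability T R) (mu : R) (X : {RV P >-> R}) : Prop :=
  [/\ P [set t | X t = 1] = (mu / 2)%:E,
      P [set t | X t = -1] = (mu / 2)%:E &
      P [set t | X t = 0] = (1 - mu)%:E].

Definition mutually_independent (R : realType) (d : measure_display)
    (T : measurableType d) (P : probability T R) (S : finType)
    (X : S -> {RV P >-> R}) : Prop :=
  forall (J : {set S}) (B : S -> set R),
    (forall s, measurable (B s)) ->
    P (\bigcap_(s in [set` J]) (X s @^-1` B s)) =
    (\prod_(s in J) P (X s @^-1` B s))%E.

Definition join_family (V : Type) (n : nat) (x y : 'I_n -> V)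
    (s : 'I_n + 'I_n) : V :=
  match s with inl i => x i | inr j => y j end.

Definition rho_b (R : realType) (d : measure_display) (T : measurableType d)
    (P : probability T R) (n : nat) (A : 'M[R]_n)
    (x y : 'I_n -> {RV P >-> R}) : \bar R :=
  ereal_sup (range (fun a : R =>
    P [set t | \sum_(i < n) \sum_(j < n) A i j * x i t * y j t = a])).

Record sym_gap (R : realType) (r : nat) := SymGap {
  gap_gen : 'I_r -> R;
  gap_bound : 'I_r -> nat
}.

Definition gap_box (R : realType) (r : nat) (Q : sym_gap R r) :
    set {ffun 'I_r -> int} :=
  [set m | forall h, (`|m h| <= gap_bound Q h)%N].

Definition gap_val (R : realType) (r : nat) (Q : sym_gap R r)
    (m : {ffun 'I_r -> int}) : R :=
  \sum_(h < r) (m h)%:~R * gap_gen Q h.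

Definition gap_set (R : realType) (r : nat) (Q : sym_gap R r) : set R :=
  gap_val Q @` gap_box Q.

Definition gap_proper (R : realType) (r : nat) (Q : sym_gap R r) : Prop :=
  set_inj (gap_box Q) (gap_val Q).

(* Main.v *)
(* A linear inverse theorem is applied twice.  If [sum_i v_i x_i] has an atom of
   mass [n^-C], then all but [n^eps] of the [v_j] satisfy [D v_j = sum_h c_h w_h]
   with boundedly many generators [w_h] among the [v_i] and polynomially bounded
   integers [D], [c_h].  For the bilinear form, condition on [y]: for a
   polynomial proportion of [y] this applies to the vector with entries
   [b_i(y) = sum_j a_ij y_j]; by pigeonhole the generators [I_0] and [k = D] do
   not depend on [y], and, [i] being fixed, neither do the coefficients.  So
   [sum_j y_j (k a_ij + sum k_(i i_0) a_(i_0 j)) = 0] with polynomial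
   probability, and the linear theorem, now in [y], puts its coefficients in a
   GAP, which rank reduction along its relations makes proper.

   The linear theorem is a greedy argument in the style of Tao and Vu.  For
   walks with nonnegative Fourier transform, any block of [m] coefficients can be
   replaced by [m] copies of one of them without decreasing the return
   probability (Hoelder).  First, coefficients without a short integer relation
   to those already chosen are extracted; each divides the atom by a power of
   [n], so boundedly many are chosen and every other [v_j] is, outside a few
   blocks, a rational combination of them of polynomial height.  Its denominator
   still depends on [j].  Second, one works with these rational vectors modulo
   the lattice spanned so far: adjoining a vector of order [q] divides the atom
   by a power of [min(q, m)], so the index of the final lattice, hence a common
   denominator [D], is polynomial.  The first relations hold at scales decreasing
   fast enough to make real and formal relations agree in the second stage. *)

Require Import Defs.
From mathcomp Require Import ring lra zify.

Set Implicit Arguments.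
Unset Strict Implicit.
Unset Printing Implicit Defensive.

Local Open Scope ring_scope.

(** * Finitely supported symmetric walks and their return probabilities *)

Section Expectation.
Context {R : realType}.

(* Each item [(a, u)] of [s] contributes an independent copy of [eta^a] times [u]. *)
Fixpoint expect (V : zmodType) (s : seq (R * V)) (f : V -> R) : R :=
  if s is (a, u) :: s' then
    (1 - a) * expect s' f
    + a / 2 * (expect s' (fun z => f (u + z)) + expect s' (fun z => f (z - u)))
  else f 0.

Definition prob0 (V : zmodType) (s : seq (R * V)) : R :=
  expect s (fun z => (z == 0)%:R).

Lemma eq_expect (V : zmodType) (s : seq (R * V)) f g :
  f =1 g -> expect s f = expect s g.
Proof.
elim: s f g => [|[a u] s IH] f g fg /=; first exact: fg.
by congr (_ * _ + _ * (_ + _)); apply: IH => z.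
Qed.

Lemma expect_linear (V : zmodType) (s : seq (R * V)) c d f g :
  expect s (fun z => c * f z + d * g z) = c * expect s f + d * expect s g.
Proof.
elim: s f g => [|[a u] s IH] f g //=.
rewrite (IH f g) (IH (fun z => f (u + z)) (fun z => g (u + z))).
rewrite (IH (fun z => f (z - u)) (fun z => g (z - u))).
by ring.
Qed.

Lemma expectD (V : zmodType) (s : seq (R * V)) f g :
  expect s (fun z => f z + g z) = expect s f + expect s g.
Proof.
have := expect_linear s 1 1 f g; rewrite !mul1r => <-.
by apply: eq_expect => z; rewrite !mul1r.
Qed.

Lemma expectZ (V : zmodType) (s : seq (R * V)) c f :
  expect s (fun z => c * f z) = c * expect s f.
Proof.
have := expect_linear s c 0 f f; rewrite mul0r addr0 => <-.
by apply: eq_expect => z; rewrite mul0r addr0.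
Qed.

Lemma expect_cst (V : zmodType) (s : seq (R * V)) c : expect s (fun=> c) = c.
Proof. by elim: s => [|[a u] s IH] //=; rewrite IH; field. Qed.

Lemma expect_exchange (V W : zmodType) (s : seq (R * V)) (t : seq (R * W)) (f : V -> W -> R) :
  expect s (fun x => expect t (fun y => f x y)) =
  expect t (fun y => expect s (fun x => f x y)).
Proof.
elim: s f => [|[a u] s IH] f //=.
rewrite (IH f) (IH (fun x y => f (u + x) y)) (IH (fun x y => f (x - u) y)).
by rewrite -expectD -!expectZ -expectD.
Qed.

Lemma expect_cat (V : zmodType) (s t : seq (R * V)) f :
  expect (s ++ t) f = expect s (fun x => expect t (fun y => f (x + y))).
Proof.
elim: s f => [|[a u] s IH] f /=; first by apply: eq_expect => y; rewrite add0r.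
rewrite !IH; congr (_ * _ + _ * (_ + _)); apply: eq_expect => x;
  by apply: eq_expect => y; rewrite ?addrA // addrAC.
Qed.

Lemma expect_catC (V : zmodType) (s t : seq (R * V)) f :
  expect (s ++ t) f = expect (t ++ s) f.
Proof.
rewrite !expect_cat expect_exchange.
by apply: eq_expect => y; apply: eq_expect => x; rewrite addrC.
Qed.

Lemma expect_perm (V : zmodType) (s t : seq (R * V)) :
  perm_eq s t -> expect s =1 expect t.
Proof.
move=> st f; apply/eqP; pose Q r := expect r f == expect t f.
rewrite -/(Q s); rewrite perm_sym in st; apply: (@catCA_perm_ind _ Q _ t s st); last exact: eqxx.
move=> s1 s2 s3; rewrite /Q => /eqP <-; apply/eqP.
rewrite !catA !(expect_cat (_ ++ _)).
exact: expect_catC.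
Qed.

Lemma expect_sym (V : zmodType) (s : seq (R * V)) f :
  expect s (fun z => f (- z)) = expect s f.
Proof.
elim: s f => [|[a u] s IH] f /=; first by rewrite oppr0.
rewrite (IH f) -(IH (fun z => f (u + z))) -(IH (fun z => f (z - u))).
congr (_ + _ * _); rewrite addrC; congr (_ + _); apply: eq_expect => z; congr f.
  by rewrite opprB addrC.
by rewrite opprD addrC.
Qed.

Lemma expect_map (V W : zmodType) (h : V -> W) (s : seq (R * V)) f :
  {morph h : x y / x - y} ->
  expect [seq (p.1, h p.2) | p <- s] f = expect s (fun z => f (h z)).
Proof.
move=> hB; have h0 : h 0 = 0 by rewrite -(subrr 0) hB subrr.
have hD x y : h (x + y) = h x + h y.
  by rewrite -{1}(opprK y) -[- y]sub0r !hB h0 sub0r opprK.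
elim: s f => [|[a u] s IH] f /=; first by rewrite h0.
rewrite !IH; congr (_ * _ + _ * (_ + _)); apply: eq_expect => z.
  by rewrite hD.
by rewrite hB.
Qed.

(** The law of the walk as a weighted list with repetitions: a value reached in several ways occurs
    several times. *)
Fixpoint outcomes (V : zmodType) (s : seq (R * V)) : seq (R * V) :=
  if s is (a, u) :: s' then
    [seq ((1 - a) * p.1, p.2) | p <- outcomes s']
    ++ [seq (a / 2 * p.1, u + p.2) | p <- outcomes s']
    ++ [seq (a / 2 * p.1, p.2 - u) | p <- outcomes s']
  else [:: (1, 0)].

Lemma expect_outcomes (V : zmodType) (s : seq (R * V)) f :
  expect s f = \sum_(p <- outcomes s) p.1 * f p.2.
Proof.
elim: s f => [|[a u] s IH] f /=; first by rewrite big_seq1 mul1r.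
rewrite !big_cat !big_map /= !IH mulrDr !mulr_sumr.
by congr (_ + (_ + _)); apply: eq_bigr => p _; rewrite mulrA.
Qed.

(** Grouping the entries by their value turns the double sum into a sum of squares. Weights may be
    negative, so signed differences of laws are covered. *)
Lemma coincidence_sum_ge0 (V : eqType) (r : seq (R * V)) :
  0 <= \sum_(p <- r) \sum_(q <- r) p.1 * q.1 * (p.2 == q.2)%:R.
Proof.
pose X := undup [seq p.2 | p <- r].
have -> : \sum_(p <- r) \sum_(q <- r) p.1 * q.1 * (p.2 == q.2)%:R
  = \sum_(x <- X) (\sum_(p <- r) p.1 * (p.2 == x)%:R) ^+ 2.
  under [RHS]eq_bigr do rewrite expr2 mulr_suml.
  rewrite [RHS]exchange_big /=; apply: eq_big_seq => p pr.
  under [RHS]eq_bigr do rewrite mulr_sumr.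
  rewrite [RHS]exchange_big /=; apply: eq_bigr => q _.
  rewrite (bigD1_seq p.2) ?undup_uniq ?mem_undup ?map_f//= eqxx mulr1.
  rewrite big1 ?addr0 ?mulrA 1?eq_sym// => x xp.
  by rewrite [p.2 == x]eq_sym (negbTE xp) mulr0 mul0r.
by apply: sumr_ge0 => x _; exact: sqr_ge0.
Qed.

(** A walk is symmetric, so the sum of two independent walks vanishes with the probability that they
    coincide. *)
Lemma prob0_cat (V : zmodType) (s t : seq (R * V)) :
  prob0 (s ++ t) = \sum_(p <- outcomes s) \sum_(q <- outcomes t) p.1 * q.1 * (p.2 == q.2)%:R.
Proof.
rewrite /prob0 expect_cat expect_outcomes; apply: eq_bigr => p _.
rewrite -expect_sym expect_outcomes mulr_sumr; apply: eq_bigr => q _.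
by rewrite subr_eq0 mulrA.
Qed.

(** Positivity of the coincidence form, evaluated at the difference of the laws of [s] and [t]. *)
Lemma prob0_cauchy (V : zmodType) (s t : seq (R * V)) :
  2 * prob0 (s ++ t) <= prob0 (s ++ s) + prob0 (t ++ t).
Proof.
have := coincidence_sum_ge0 (outcomes s ++ [seq (- p.1, p.2) | p <- outcomes t]).
rewrite big_cat /= big_map /=.
under eq_bigr => p _ do rewrite big_cat big_map /=.
under [X in _ <= _ + X]eq_bigr => p _ do rewrite big_cat big_map /=.
rewrite !big_split /= -!prob0_cat.
have -> : \sum_(p <- outcomes s) \sum_(q <- outcomes t) p.1 * - q.1 * (p.2 == q.2)%:R =
    - prob0 (s ++ t).
  rewrite prob0_cat -sumrN; apply: eq_bigr => p _; rewrite -sumrN.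
  by apply: eq_bigr => q _; rewrite mulrN mulNr.
have -> : \sum_(p <- outcomes t) \sum_(q <- outcomes s) - p.1 * q.1 * (p.2 == q.2)%:R =
    - prob0 (t ++ s).
  rewrite prob0_cat -sumrN; apply: eq_bigr => p _; rewrite -sumrN.
  by apply: eq_bigr => q _; rewrite !mulNr.
have -> : \sum_(p <- outcomes t) \sum_(q <- outcomes t) - p.1 * - q.1 * (p.2 == q.2)%:R =
    prob0 (t ++ t).
  rewrite prob0_cat; apply: eq_bigr => p _.
  by apply: eq_bigr => q _; rewrite mulrNN.
have -> : prob0 (t ++ s) = prob0 (s ++ t) by exact: expect_catC.
by lra.
Qed.

Definition lazy (V : zmodType) (s : seq (R * V)) := all (fun p => 0 <= p.1 <= 1) s.

Lemma le_expect (V : zmodType) (s : seq (R * V)) f g : lazy s ->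
  (forall z, f z <= g z) -> expect s f <= expect s g.
Proof.
elim: s f g => [|[a u] s IH] f g /=; first by move=> _; exact.
move=> /andP[/andP[a0 a1] ls] fg.
rewrite lerD ?ler_wpM2l ?subr_ge0 ?divr_ge0 ?lerD ?IH// => z; exact: fg.
Qed.

Lemma expect_ge0 (V : zmodType) (s : seq (R * V)) f : lazy s ->
  (forall z, 0 <= f z) -> 0 <= expect s f.
Proof. by move=> ls f0; rewrite -(expect_cst s 0); exact: le_expect. Qed.

Lemma expect_le_cst (V : zmodType) (s : seq (R * V)) f c : lazy s ->
  (forall z, f z <= c) -> expect s f <= c.
Proof. by move=> ls f0; rewrite -(expect_cst s c); exact: le_expect. Qed.

(* If [b] is the atom, the conditional law given [X = b] shows
   [P(X = b)^2 <= P(X = X')]. *)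
Lemma sqr_atom_le_prob0 (V : zmodType) (s : seq (R * V)) (b : V) : lazy s ->
  expect s (fun z => (z == b)%:R) ^+ 2 <= prob0 (s ++ s).
Proof.
move=> ls; rewrite /prob0 expect_cat.
set p := expect s _.
have -> : p ^+ 2 = expect s (fun x => (x == b)%:R * p).
  by rewrite expr2 {2}/p -expectZ; apply: eq_expect => z; rewrite mulrC.
apply: le_expect => // x; case: (eqVneq x b) => [->|_]; rewrite ?mul1r ?mul0r.
  rewrite /p -[leRHS]expect_sym; apply: le_expect => // y.
  by rewrite subr_eq0 eq_sym.
by apply: expect_ge0 => // y; case: eqP.
Qed.

Lemma expect_neq0_supp (V : zmodType) (s : seq (R * V)) f :
  expect s f != 0 -> exists2 z, f z != 0 & z \in [seq p.2 | p <- outcomes s].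
Proof.
rewrite expect_outcomes => h.
have [/hasP[p ps fp]|/hasPn H] := boolP (has (fun p => f p.2 != 0) (outcomes s)).
  by exists p.2 => //; exact: map_f.
case/eqP: h; apply: big1_seq => p /andP[_ ps].
by have := H p ps; rewrite negbK => /eqP ->; rewrite mulr0.
Qed.

End Expectation.

(** * Trading blocks of coefficients for copies of one coefficient *)

Section Replacement.
Context {R : realType}.

Definition rep (T : Type) (e : nat) (s : seq T) : seq T :=
  flatten [seq nseq e x | x <- s].

Lemma rep_cat (T : Type) e (s t : seq T) : rep e (s ++ t) = rep e s ++ rep e t.
Proof. by rewrite /rep map_cat flatten_cat. Qed.

Lemma map_rep (T T' : Type) (h : T -> T') e (s : seq T) :
  map h (rep e s) = rep e (map h s).
Proof.
rewrite /rep map_flatten -!map_comp; congr flatten.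
by apply: eq_map => x /=; rewrite map_nseq.
Qed.

Lemma count_rep (T : Type) (a : pred T) e (s : seq T) :
  count a (rep e s) = (e * count a s)%N.
Proof.
elim: s => [|x s IH] /=; first by rewrite muln0.
by rewrite /rep /= count_cat count_nseq -/(rep e s) IH mulnDr mulnC.
Qed.

(** In this form, reorderings of a walk reduce to linear arithmetic on counts. *)
Lemma eq_prob0_count (V : zmodType) (s t : seq (R * V)) :
  (forall a, count a s = count a t) -> prob0 s = prob0 t.
Proof. by move=> st; apply: expect_perm; apply/permP. Qed.

(* Halving the block repeatedly, each time with [prob0_cauchy], plays the role
   of Hoelder's inequality. *)
Lemma prob0_block_le (V : zmodType) (h : seq (R * V)) t e (B : seq (R * V)) :
  size B = (2 ^ t)%N ->
  exists2 x, x \in B &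
    prob0 (h ++ h ++ rep e B) <= prob0 (h ++ h ++ nseq (e * 2 ^ t) x).
Proof.
elim: t e B => [|t IH] e B.
  rewrite expn0 muln1; case: B => [|x [|]]// _; exists x; rewrite ?mem_seq1//.
  by rewrite /rep /= cats0.
move=> sB; set m := (2 ^ t)%N in IH *.
have sB1 : size (take m B) = m.
  by rewrite size_take sB expnS -/m; case: ltnP => //; lia.
have sB2 : size (drop m B) = m by rewrite size_drop sB expnS -/m; lia.
have key B' : size B' = m -> prob0 ((h ++ rep e B') ++ (h ++ rep e B')) =
    prob0 (h ++ h ++ rep (e * 2) B').
  move=> _; apply: eq_prob0_count => a; rewrite !count_cat !count_rep; lia.
(* Each half of the block now occurs twice in a walk of its own, which doubles [e]; the better of
   the two halves is kept. *)
have /= := prob0_cauchy (h ++ rep e (take m B)) (h ++ rep e (drop m B)).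
rewrite !key//.
have -> : prob0 ((h ++ rep e (take m B)) ++ (h ++ rep e (drop m B))) =
    prob0 (h ++ h ++ rep e B).
  apply: eq_prob0_count => a; rewrite !count_cat !count_rep.
  have := count_cat a (take m B) (drop m B); rewrite cat_take_drop => ->; lia.
have [x1 x1B le1] := IH (e * 2)%N _ sB1.
have [x2 x2B le2] := IH (e * 2)%N _ sB2.
rewrite -mulnA -expnS in le1 le2 => le12.
have [le|le] := lerP (prob0 (h ++ h ++ nseq (e * 2 ^ t.+1) x1))
                     (prob0 (h ++ h ++ nseq (e * 2 ^ t.+1) x2)).
  by exists x2; [exact: mem_drop x2B | lra].
by exists x1; [exact: mem_take x1B | lra].
Qed.

Definition weigh (V : Type) (a : R) (s : seq V) : seq (R * V) := [seq (a, u) | u <- s].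

Lemma lazy_weigh (V : zmodType) (a : R) (s : seq V) : 0 <= a <= 1 -> lazy (weigh a s).
Proof. by move=> a01; apply/allP => p /mapP[u _ ->]. Qed.

Lemma prob0_affine (V : zmodType) (a : R) (u : V) s :
  prob0 ((a, u) :: s) = (1 - a) * prob0 s + a * prob0 ((1, u) :: s).
Proof. by rewrite /prob0 /=; field. Qed.

(** Without Fourier transforms, this is $(1-\mu+\mu\cos)^2\le 1-\mu+\mu\cos^2$. The defect is
    $\mu(1-\mu)(x+z-2y)$, where [x], [y], [z] are the return probabilities with zero, one and two
    sign steps along [u]; [prob0_cauchy] makes it nonnegative. *)
Lemma prob0_convex (V : zmodType) (mu : R) (u : V) h : 0 <= mu <= 1 ->
  prob0 ((mu, u) :: (mu, u) :: h ++ h) <=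
  (1 - mu) * prob0 (h ++ h) + mu * prob0 ((1, u) :: (1, u) :: h ++ h).
Proof.
move=> /andP[mu0 mu1].
rewrite prob0_affine (prob0_affine mu).
have -> : prob0 ((1, u) :: (mu, u) :: h ++ h) = prob0 ((mu, u) :: (1, u) :: h ++ h).
  by apply: eq_prob0_count => a /=; rewrite addnCA.
rewrite (prob0_affine mu).
have := prob0_cauchy h ((1, u) :: h).
have -> : prob0 (h ++ (1, u) :: h) = prob0 ((1, u) :: h ++ h).
  by apply: eq_prob0_count => a /=; rewrite !count_cat/=; lia.
have -> : prob0 (((1, u) :: h) ++ (1, u) :: h) = prob0 ((1, u) :: (1, u) :: h ++ h).
  by apply: eq_prob0_count => a /=; rewrite !count_cat/=; lia.
set x := prob0 (h ++ h); set y := prob0 (_ :: h ++ h); set z := prob0 _ => xyz.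
have : 0 <= mu * (1 - mu) * (x + z - 2 * y).
  by rewrite mulr_ge0 ?mulr_ge0 ?subr_ge0.
move=> H; rewrite -subr_ge0; apply: le_trans H _.
by rewrite le_eqVlt; apply/orP; left; apply/eqP; ring.
Qed.

(** The sum of two independent signs is twice a copy of $\eta^{1/2}$. *)
Lemma expect_sign_double (t : seq R) f :
  expect (weigh 1 t ++ weigh 1 t) f = expect (weigh (1 / 2) [seq 2 * u | u <- t]) f.
Proof.
elim: t f => [//|u t IH] f.
rewrite (@expect_perm _ _ _ ((1, u) :: (1, u) :: weigh 1 t ++ weigh 1 t)); last first.
  by apply/permP => a; rewrite /= !count_cat/=; lia.
rewrite /= !IH.
rewrite (@eq_expect _ _ _ (fun z => f (u + (u + z))) (fun z => f (2 * u + z))); last first.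
  by move=> z; congr f; ring.
rewrite (@eq_expect _ _ _ (fun z => f (u + (z - u))) f); last first.
  by move=> z; congr f; ring.
rewrite (@eq_expect _ _ _ (fun z => f (u + z - u)) f); last first.
  by move=> z; congr f; ring.
rewrite (@eq_expect _ _ _ (fun z => f (z - u - u)) (fun z => f (z - 2 * u))); last first.
  by move=> z; congr f; ring.
by field.
Qed.

(* Since [cos^2 x = (1 + cos 2x) / 2], convexity of the square bounds the squared
   Fourier transform of [eta^mu] by that of [2 eta^(mu/2)]; as [mu / 2 <= 1 / 2],
   this avoids the parity obstruction of the case [mu = 1]. *)
Lemma prob0_double_le (mu : R) (s : seq R) : 0 <= mu <= 1 ->
  prob0 (weigh mu s ++ weigh mu s) <= prob0 (weigh (mu / 2) s).
Proof.
move=> mu01; have [mu0 mu1] := andP mu01.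
pose D (r : seq R) := [seq 2 * u | u <- r].
(* The list [t] holds the coefficients already turned into pure signs; the induction moves them
   there from [s] one at a time. The dilation by 2 does not affect vanishing. *)
suff H t : prob0 (let h := weigh mu s ++ weigh 1 t in h ++ h) <=
    prob0 (weigh (mu / 2) (D s) ++ weigh (1 / 2) (D t)).
  have := H [::]; rewrite /= !cats0 => /le_trans; apply.
  have -> : weigh (mu / 2) (D s) = [seq (p.1, *%R (2:R) p.2) | p <- weigh (mu / 2) s].
    by rewrite /weigh -!map_comp.
  rewrite /prob0 expect_map; last by move=> y z; rewrite mulrBr.
  apply: le_expect => [|z]; first by apply: lazy_weigh; lra.
  by rewrite mulf_eq0 pnatr_eq0.
elim: s t => [|u s IH] t /=.
  by rewrite /prob0 expect_sign_double.
set h := weigh mu s ++ weigh 1 t.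
have -> : prob0 ((mu, u) :: h ++ (mu, u) :: h) = prob0 ((mu, u) :: (mu, u) :: h ++ h).
  by apply: eq_prob0_count => a; rewrite /h /= !count_cat/= !count_cat; lia.
apply: le_trans (prob0_convex _ _ mu01) _.
have -> : prob0 ((1, u) :: (1, u) :: h ++ h) =
    prob0 (let h := weigh mu s ++ weigh 1 (u :: t) in h ++ h).
  by apply: eq_prob0_count => a; rewrite /h /= !count_cat/= ?count_cat; lia.
have H1 := IH t; have H2 := IH (u :: t); rewrite -/h in H1.
apply: le_trans (_ : (1 - mu) * prob0 (weigh (mu / 2) (D s) ++ weigh (1 / 2) (D t))
  + mu * prob0 (weigh (mu / 2) (D s) ++ weigh (1 / 2) (D (u :: t))) <= _).
  by rewrite lerD ?ler_wpM2l ?subr_ge0.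
have -> : prob0 (weigh (mu / 2) (D s) ++ weigh (1 / 2) (D (u :: t))) =
    prob0 ((1 / 2, 2 * u) :: weigh (mu / 2) (D s) ++ weigh (1 / 2) (D t)).
  by apply: eq_prob0_count => a /=; rewrite !count_cat/=; lia.
by rewrite /prob0 /= le_eqVlt; apply/orP; left; apply/eqP; field.
Qed.

(** The latest choice stands at the head, so each element is bad relative to those chosen before
    it. *)
Fixpoint chain (I : Type) (bad : seq I -> pred I) (us : seq I) : bool :=
  if us is u :: us' then bad us' u && chain bad us' else true.

(** As long as $2^t$ of the remaining indices are bad, [prob0_block_le] trades $2^t$ of them for as
    many copies of one of them, at no loss of return probability. The process stops after [T]
    rounds, or earlier with few bad indices left. The walk is doubled because the replacement needs
    a context of the form [h ++ h]. *)
Lemma greedy_choice (V : zmodType) (I : eqType) (x : I -> R * V)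
    (bad : seq I -> pred I) t sigma (r : seq I) :
  uniq r -> sigma <= prob0 (map x r ++ map x r) ->
  forall T, exists us rest,
    [/\ uniq (us ++ rest), {subset us ++ rest <= r},
        (size rest + 2 ^ t * size us = size r)%N, chain bad us &
        sigma <= prob0 (let k := map x (rest ++ rep (2 ^ t) us) in k ++ k)] /\
    (size us = T \/ (size us < T)%N /\ (count (bad us) rest < 2 ^ t)%N).
Proof.
move=> ur sr; elim=> [|T [us [rest [[uq sub sz ch le] alt]]]].
  exists [::], r; split; last by left.
  by split=> //=; rewrite ?muln0 ?addn0// /rep /= cats0.
case: alt => [szT|[szT cnt]]; last first.
  by exists us, rest; split=> //; right; split=> //; rewrite ltnS ltnW.
have [cnt|cnt] := ltnP (count (bad us) rest) (2 ^ t).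
  by exists us, rest; split=> //; right; rewrite szT.
set m := (2 ^ t)%N in cnt le sz *.
pose bd := [seq i <- rest | bad us i].
pose B := take m bd; pose rest' := drop m bd ++ [seq i <- rest | ~~ bad us i].
have sB : size B = m.
  by rewrite size_takel// size_filter.
have pr : perm_eq rest (B ++ rest').
  by rewrite perm_sym /rest' catA cat_take_drop perm_filterC.
clearbody rest'.
pose h := map x (rest' ++ rep m us).
have sBx : size (map x B) = m by rewrite size_map.
have [_ /mapP[u uB ->] hle] := prob0_block_le h 2 sBx.
have ubd : u \in bd by exact: mem_take uB.
have bu : bad us u by move: ubd; rewrite mem_filter => /andP[].
exists (u :: us), rest'; split; last by left; rewrite /= szT.
have cB a : count a (rest) = (count a B + count a rest')%N.
  by rewrite (permP pr) count_cat.
have uB' : (u \in us ++ rest) by rewrite mem_cat (perm_mem pr) mem_cat uB orbT.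
split.
- have : uniq (us ++ (B ++ rest')).
    by rewrite -(perm_uniq (_ : perm_eq (us ++ rest) _)) ?perm_cat2l.
  rewrite uniq_catCA cat_uniq => /and3P[_ /hasPn H U].
  by rewrite /= U andbT; apply/negP => /H /negP; apply.
- move=> i; rewrite /= inE => /orP[/eqP ->|]; first exact: sub.
  rewrite mem_cat => /orP[iu|ir]; apply: sub; rewrite mem_cat ?iu//.
  by rewrite (perm_mem pr) mem_cat ir !orbT.
- have := perm_size pr; rewrite size_cat sB /=; lia.
- by rewrite /= bu.
- apply: le_trans le _.
  have -> : prob0 (let k := map x (rest ++ rep m us) in k ++ k) = prob0 (h ++ h ++ rep 2 (map x B)).
    apply: eq_prob0_count => a; rewrite /h /= !map_cat !map_rep !count_cat !count_rep.
    rewrite !count_map !cB; lia.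
  apply: le_trans hle _; rewrite le_eqVlt; apply/orP; left; apply/eqP.
  apply: eq_prob0_count => a; rewrite /h /= !map_cat !map_rep !count_cat /= !count_rep.
  by rewrite !count_map !count_nseq /= /m; lia.
Qed.

End Replacement.

(** * Averages over a binomial number of steps *)

Section BinomialMixture.
Context {R : realType}.

(** The mean of [f] under the binomial law with [m] trials of success probability [p]. *)
Fixpoint binexp (p : R) (m : nat) (f : nat -> R) : R :=
  if m is m'.+1 then (1 - p) * binexp p m' f + p * binexp p m' (f \o succn) else f 0%N.

Lemma binexp_linear p m c d f g :
  binexp p m (fun j => c * f j + d * g j) = c * binexp p m f + d * binexp p m g.
Proof.
elim: m f g => [//|m IH] f g /=.
by rewrite IH [binexp p m (_ \o _)](IH (f \o succn) (g \o succn)); ring.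
Qed.

Lemma le_binexp p m f g : 0 <= p <= 1 -> (forall j, f j <= g j) ->
  binexp p m f <= binexp p m g.
Proof.
move=> p01; have [p0 p1] := andP p01; elim: m f g => [|m IH] f g fg //=.
by rewrite lerD ?ler_wpM2l ?subr_ge0 ?IH// => j /=.
Qed.

Lemma eq_binexp p m f g : f =1 g -> binexp p m f = binexp p m g.
Proof.
elim: m f g => [|m IH] f g fg //=; rewrite (IH f g)//; congr (_ + _ * _).
by apply: IH => j /=.
Qed.

Lemma binexp_cst p m c : binexp p m (fun=> c) = c.
Proof. by elim: m => //= m IH; rewrite /comp IH; ring. Qed.

(** Size biasing of the binomial law, by conditioning on one trial. At [j = 0] the truncated
    predecessor is harmless, its term having the factor 0. *)
Lemma binexp_size_bias p m f :
  binexp p m.+1 (fun j => j%:R * f j.-1) = m.+1%:R * p * binexp p m f.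
Proof.
elim: m f => [|m IH] f; first by rewrite /= mul0r; ring.
have -> : binexp p m.+2 (fun j => j%:R * f j.-1) =
  (1 - p) * binexp p m.+1 (fun j => j%:R * f j.-1) +
  p * binexp p m.+1 (fun j => 1 * (j%:R * (f \o succn) j.-1) + 1 * f j).
  rewrite [LHS]/=; congr (_ * _ + _ * _).
  apply: (@eq_binexp p m.+1) => j /=; rewrite -natr1.
  by case: j => [|j] /=; ring.
by rewrite binexp_linear !IH /= -!natr1; ring.
Qed.

(** Size biasing applied to $f(j)=1/(j+1)$, for which $j f(j-1)\le 1$. *)
Lemma binexp_inv_le p m : 0 < p <= 1 ->
  m.+1%:R * p * binexp p m (fun j => j.+1%:R^-1) <= 1.
Proof.
move=> /andP[p0 p1]; rewrite -binexp_size_bias -[leRHS](binexp_cst p m.+1).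
apply: le_binexp => [|[|j]] /=; [by rewrite ltW|by rewrite mul0r|].
by rewrite mulfV ?pnatr_eq0.
Qed.

End BinomialMixture.

(** * Central binomial coefficients *)

Definition binz (n : nat) (z : int) : nat := if z is Posz k then 'C(n, k) else 0%N.

(** Extension by zero to negative integers frees Pascal's rule from side conditions. *)
Lemma binzS n z : binz n.+1 z = (binz n z + binz n (z - 1))%N.
Proof.
case: z => [[|k]|k]; first by rewrite /= !bin0.
- by have -> : Posz k.+1 - 1 = Posz k by lia.
- by have -> : Negz k - 1 = Negz k.+1 by lia.
Qed.

Lemma bin_le_central j k : ('C(j.*2, k) <= 'C(j.*2, j))%N.
Proof.
have step n i : (i.*2 < n)%N -> ('C(n, i) <= 'C(n, i.+1))%N.
  move=> lt; have := mul_bin_left n i.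
  rewrite -(leq_pmul2l (ltn0Sn i)) => ->; rewrite leq_mul2r; lia.
have below i d : (i + d <= j)%N -> ('C(j.*2, i) <= 'C(j.*2, i + d))%N.
  elim: d => [|d IH] le; first by rewrite addn0.
  by rewrite addnS; apply: leq_trans (IH _) (step _ _ _); lia.
have low i : (i <= j)%N -> ('C(j.*2, i) <= 'C(j.*2, j))%N.
  by move=> le; rewrite -[X in (_ <= 'C(_, X))%N](subnKC le) below// subnKC.
have [|lt] := leqP k j; first exact: low.
have [le|gt] := leqP k j.*2; last by rewrite bin_small.
by rewrite -bin_sub//; apply: low; lia.
Qed.

Lemma central_binS j : (j.+1 * 'C(j.+1.*2, j.+1) = 2 * (j.*2.+1 * 'C(j.*2, j)))%N.
Proof.
rewrite doubleS; have /= <- := mul_bin_diag j.*2.+2 j.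
have -> : 'C(j.*2.+1, j) = 'C(j.*2.+1, j.+1) by rewrite -[LHS]bin_sub; [congr 'C(_, _); lia|lia].
have /= := mul_bin_diag j.*2.+1 j; lia.
Qed.

(** The bound $\binom{2j}{j}4^{-j}\le (j+1)^{-1/2}$ in integer form. By [central_binS] the inductive
    step is the polynomial inequality $4(2j+1)^2(j+2)\le 16(j+1)^3$. *)
Lemma central_bin_bound j : ('C(j.*2, j) ^ 2 * j.+1 <= 16 ^ j)%N.
Proof.
elim: j => [//|j IH]; rewrite -(leq_pmul2l (_ : 0 < j.+1 ^ 2)%N) ?expn_gt0//.
have -> : (j.+1 ^ 2 * ('C(j.+1.*2, j.+1) ^ 2 * j.+2) =
    (j.+1 * 'C(j.+1.*2, j.+1)) ^ 2 * j.+2)%N by rewrite expnMn; lia.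
rewrite central_binS; set b := 'C(_, _) in IH *.
have poly : (4 * j.*2.+1 ^ 2 * j.+2 <= 16 * j.+1 ^ 3)%N by nia.
have -> : ((2 * (j.*2.+1 * b)) ^ 2 * j.+2 = b ^ 2 * (4 * j.*2.+1 ^ 2 * j.+2))%N.
  by rewrite !expnMn; lia.
apply: leq_trans (leq_mul (leqnn _) poly) _.
have -> : (b ^ 2 * (16 * j.+1 ^ 3) = 16 * j.+1 ^ 2 * (b ^ 2 * j.+1))%N by rewrite (expnS _ 2); lia.
by apply: leq_trans (leq_mul (leqnn _) IH) _; rewrite [(16 ^ j.+1)%N]expnS; lia.
Qed.

(** * Concentration of one-dimensional walks in residue classes *)

Section Gain.
Context {R : realType}.

Definition walk (nu : R) (m : nat) : seq (R * int) := nseq m (nu, 1).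

(** A step of $\eta^{1/2}$ is half a sum of two signs, so [j] steps follow the law of $2j$ fair
    trials, centred at [j]. *)
Lemma fair_walk_law j a :
  expect (walk (1 / 2) j) (fun z => (z == a)%:R) = (binz j.*2 (j%:Z + a))%:R / 4 ^+ j.
Proof.
elim: j a => [|j IH] a /=.
  rewrite add0r divr1; case: a => [[|k]|k] //=.
have h1 : expect (walk (1 / 2) j) (fun z => (1 + z == a)%:R) =
    (binz j.*2 (j%:Z + a - 1))%:R / 4 ^+ j.
  rewrite -addrA -IH; apply: eq_expect => z; congr (_%:R); congr nat_of_bool.
  by apply/eqP/eqP; lia.
have h2 : expect (walk (1 / 2) j) (fun z => (z - 1 == a)%:R) =
    (binz j.*2 (j%:Z + a + 1))%:R / 4 ^+ j.
  rewrite -addrA -IH; apply: eq_expect => z; congr (_%:R); congr nat_of_bool.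
  by apply/eqP/eqP; lia.
rewrite -/(walk _ _) h1 h2 IH doubleS !binzS.
have -> : j.+1%:Z + a = j%:Z + a + 1 by lia.
rewrite addrK !natrD exprS.
have : 4 ^+ j != 0 :> R by rewrite expf_neq0// pnatr_eq0.
by move=> ?; field.
Qed.

Lemma fair_walk_sqr_le j a :
  expect (walk (1 / 2) j) (fun z => (z == a)%:R) ^+ 2 <= (j.+1%:R^-1 : R).
Proof.
rewrite fair_walk_law expr_div_n.
have -> : (4 ^+ j) ^+ 2 = (16 ^ j)%:R :> R.
  by rewrite natrX -exprM mulnC exprM; congr (_ ^+ j); ring.
rewrite -natrX.
rewrite ler_pdivrMr ?ltr0n ?expn_gt0// mulrC ler_pdivlMr// -natrM ler_nat.
apply: leq_trans (central_bin_bound j); rewrite leq_mul2r leq_sqr; apply/orP; right.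
by case: (j%:Z + a) => [k|k] //=; exact: bin_le_central.
Qed.

Lemma lazy_walk nu m : 0 <= nu <= 1 -> lazy (walk nu m).
Proof. by move=> h; rewrite /lazy all_nseq /= h orbT. Qed.

(** A copy of $\eta^{p/2}$ is, with probability [p], a copy of $\eta^{1/2}$ and otherwise 0; the
    number of fair steps is therefore binomial. *)
Lemma lazy_walk_mixture (p : R) m f :
  expect (walk (p / 2) m) f = binexp p m (fun j => expect (walk (1 / 2) j) f).
Proof.
elim: m f => [//|m IH] f; rewrite [LHS]/= -/(walk _ _) !IH /=.
have -> : binexp p m ((fun j => expect (walk (1 / 2) j) f) \o succn) =
  binexp p m (fun j => 1 * ((1 / 2) * expect (walk (1 / 2) j) f) +
   (1 / 4) * (1 * expect (walk (1 / 2) j) (fun z => f (1 + z)) +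
              1 * expect (walk (1 / 2) j) (fun z => f (z - 1)))).
  by apply: eq_binexp => j /=; rewrite -/(walk _ _); field.
rewrite (binexp_linear p m 1 (1 / 4)).
rewrite (binexp_linear p m 1 1).
have -> : binexp p m (fun j => 1 / 2 * expect (walk (1 / 2) j) f) =
  1 / 2 * binexp p m (fun j => expect (walk (1 / 2) j) f).
  have := binexp_linear p m (1/2) 0 (fun j => expect (walk (1 / 2) j) f) (fun=> 0).
  rewrite [X in _ = _ + X]mul0r addr0 => <-.
  by apply: eq_binexp => j; rewrite mul0r addr0.
by field.
Qed.

Lemma lazy_walk_atom_le (p : R) m a : 0 < p <= 1 ->
  expect (walk (p / 2) m) (fun z => (z == a)%:R) <= (Num.sqrt (p * m.+1%:R))^-1.
Proof.
move=> p01; have [p0 p1] := andP p01.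
set c := Num.sqrt _; have c0 : 0 < c by rewrite sqrtr_gt0 mulr_gt0.
have c2 : c ^+ 2 = p * m.+1%:R by rewrite sqr_sqrtr// mulr_ge0// ltW.
rewrite lazy_walk_mixture.
(* The inequality $b\le \frac c2 b^2+\frac1{2c}$ linearises the square root, so that only the mean
   of $1/(j+1)$ is needed. *)
apply: le_trans (_ : binexp p m (fun j => c / 2 * j.+1%:R^-1 + (c^-1 / 2) * 1) <= _).
  apply: le_binexp => [|j]; first by lra.
  have := fair_walk_sqr_le j a; set b := expect _ _ => b2.
  have : 0 <= c / 2 * (b - c^-1) ^+ 2 by rewrite mulr_ge0 ?sqr_ge0// divr_ge0// ltW.
  have -> : c / 2 * (b - c^-1) ^+ 2 = c / 2 * b ^+ 2 + c^-1 / 2 - b.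
    by field; rewrite gt_eqF.
  rewrite subr_ge0 => /le_trans; apply; rewrite mulr1 lerD2r ler_wpM2l// divr_ge0// ltW//.
rewrite binexp_linear binexp_cst mulr1.
have := binexp_inv_le m p01; set x := binexp _ _ _ => hx.
have {}hx : c ^+ 2 * x <= 1 by rewrite c2 [p * _]mulrC.
have : c * x <= c^-1 by rewrite -(ler_pM2l c0) mulrA -expr2 divff ?gt_eqF.
lra.
Qed.

Definition supp (V : zmodType) (s : seq (R * V)) : seq V := [seq p.2 | p <- outcomes s].

Lemma outcomes_ge0 (V : zmodType) (s : seq (R * V)) p :
  lazy s -> p \in outcomes s -> 0 <= p.1.
Proof.
elim: s p => [|[a u] s IH] p /=; first by rewrite inE => _ /eqP ->.
move=> /andP[/andP[/= a0 a1] ls]; rewrite !mem_cat => /orP[|/orP[|]] /mapP[q qs ->] /=;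
  by rewrite mulr_ge0 ?subr_ge0 ?divr_ge0 ?IH.
Qed.

Lemma le_expect_supp (V : zmodType) (s : seq (R * V)) f g : lazy s ->
  {in supp s, forall z, f z <= g z} -> expect s f <= expect s g.
Proof.
move=> ls fg; rewrite !expect_outcomes big_seq [leRHS]big_seq; apply: ler_sum => p ps.
by rewrite ler_wpM2l ?fg ?map_f// (outcomes_ge0 ls).
Qed.

Lemma supp_cons (V : zmodType) a (u : V) (s : seq (R * V)) z :
  z \in supp ((a, u) :: s) -> exists2 c : int, (`|c| <= 1)%N & z - u *~ c \in supp s.
Proof.
rewrite /supp /= !map_cat -!map_comp !mem_cat => /orP[|/orP[|]] /mapP[q qs ->] /=.
- by exists 0 => //; rewrite mulr0z subr0 map_f.
- by exists 1 => //; rewrite mulr1z addrC addKr map_f.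
- by exists (-1) => //; rewrite mulrN1z opprK subrK map_f.
Qed.

Lemma supp_walk nu m z : z \in supp (walk nu m) -> (`|z| <= m)%N.
Proof.
elim: m z => [|m IH] z; first by rewrite /supp /= inE => /eqP ->.
move=> /supp_cons[c c1 /IH]; rewrite intz; lia.
Qed.

(** A bound uniform over all translates survives the addition of independent steps. *)
Lemma expect_le_sup (V : zmodType) (s t : seq (R * V)) (P : V -> pred V) b :
  (forall a x z, P a (x + z) = P (a - x) z) -> lazy s ->
  (forall a, expect t (fun z => (P a z)%:R) <= b) ->
  forall a, expect (s ++ t) (fun z => (P a z)%:R) <= b.
Proof.
move=> PD ls h a; rewrite expect_cat; apply: expect_le_cst => // x.
by rewrite (eq_expect _ (g := fun z => (P (a - x) z)%:R)) // => z; rewrite PD.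
Qed.

Definition res (q : nat) (a z : int) : bool := (q%:Z %| z - a)%Z.

Lemma res_add q a x z : res q a (x + z) = res q (a - x) z.
Proof. by rewrite /res opprB addrA [x + z]addrC. Qed.

Lemma walk_res_monotone nu M m q b : 0 <= nu <= 1 -> (M <= m)%N ->
  (forall a, expect (walk nu M) (fun z => (res q a z)%:R) <= b) ->
  forall a, expect (walk nu m) (fun z => (res q a z)%:R) <= b.
Proof.
move=> nu01 Mm h a; have -> : walk nu m = walk nu (m - M) ++ walk nu M.
  by rewrite /walk -nseqD subnK.
by apply: expect_le_sup; [exact: res_add | exact: lazy_walk | exact: h].
Qed.

(** A walk confined to $[-M,M]$ with $2M<q$ meets a residue class in at most one point, so the bound
    for a single atom applies. *)
Lemma short_walk_res (p : R) M q a : 0 < p <= 1 -> (M.*2 < q)%N ->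
  expect (walk (p / 2) M) (fun z => (res q a z)%:R) <= (Num.sqrt (p * M.+1%:R))^-1.
Proof.
move=> p01 Mq; have nu01 : 0 <= p / 2 <= 1 by lra.
have [/hasP[z0 sz0 rz0]|/hasPn H] := boolP (has (res q a) (supp (walk (p / 2) M))).
  apply: le_trans (lazy_walk_atom_le M z0 p01); apply: le_expect_supp; first exact: lazy_walk.
  move=> z sz; case: (boolP (res q a z)) => rz; last by case: eqP.
  suff -> : z = z0 by rewrite eqxx.
  have := supp_walk sz; have := supp_walk sz0.
  have : (q%:Z %| z - z0)%Z.
    by have := rpredB rz rz0; rewrite opprB addrA subrK.
  move=> /dvdzP[k hk] *; suff : k = 0 by lia.
  nia.
apply: le_trans (_ : 0 <= _); last by rewrite invr_ge0 sqrtr_ge0.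
rewrite -[leRHS](expect_cst (walk (p / 2) M)); apply: le_expect_supp; first exact: lazy_walk.
by move=> z /H /negbTE ->.
Qed.

Lemma one_step_res (p : R) q a : 0 < p <= 1 -> (1 < q)%N ->
  expect (walk (p / 2) 1) (fun z => (res q a z)%:R) <= 1 - p / 2.
Proof.
move=> p01 q1; rewrite /= add0r addr0.
have ndvd : ~~ (q%:Z %| 1)%Z by rewrite dvdz1 /=; lia.
have [r0|r0] := boolP (res q a 0); last first.
  rewrite mulr0 add0r.
  have b1 (b : bool) : b%:R <= 1 :> R by case: b.
  apply: le_trans (_ : p / 2 / 2 * (1 + 1) <= _); last by lra.
  by rewrite ler_wpM2l ?lerD ?b1//; lra.
have -> : res q a 1 = false.
  apply: contraNF ndvd => r1; have := rpredB r1 r0.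
  by rewrite opprB addrA subrK subr0.
have -> : res q a (-1) = false.
  apply: contraNF ndvd => r1; have := rpredB r0 r1.
  by rewrite opprB addrA subrK opprK add0r.
by rewrite mulr1 addr0 mulr0 addr0.
Qed.

(** For $\min(q,m)$ below a constant [B], one step already costs the factor $1-\mu/2$, and a large
    exponent suffices. Otherwise a walk too short to wrap around modulo [q] gives
    $O(\min(q,m)^{-1/2})$. *)
Lemma walk_gain (mu : R) : 0 < mu <= 1 ->
  exists e : nat, forall m q, (0 < m)%N -> (1 < q)%N ->
  exists2 g, 0 <= g /\ g ^+ e * (minn q m)%:R <= 1 &
    forall a, expect (walk (mu / 2) m) (fun z => (res q a z)%:R) <= g.
Proof.
move=> mu01; have [mu0 mu1] := andP mu01.
(* Above this threshold the constant in the square-root bound is absorbed by passing to exponent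
   4. *)
have [B hB] : exists B : nat, 4 / mu ^+ 2 <= B%:R.
  exists (Num.trunc (4 / mu ^+ 2)).+1; apply/ltW/truncnS_gt.
have h01 : 0 <= 1 - mu / 2 < 1 by lra.
have [e1 he1] : exists e1 : nat, (1 - mu / 2) ^+ e1 * B%:R <= 1.
  have B0 : 0 < B%:R :> R by apply: lt_le_trans hB; rewrite divr_gt0 ?exprn_gt0.
  have h1 : `|1 - mu / 2| < 1 by rewrite ger0_norm; lra.
  have B0' : 0 < B%:R^-1 :> R by rewrite invr_gt0.
  have [N _ /(_ N (leqnn N))] := (@cvgrPdist_lt _ _ _ _ _ _ _).1 (cvg_expr h1) _ B0'.
  rewrite /= sub0r normrN ger0_norm ?exprn_ge0//; last by lra.
  by move=> h; exists N; rewrite -ler_pdivlMr// div1r ltW.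
exists (maxn 4 e1) => m q m0 q1.
have mn0 : 0 < (minn q m)%:R :> R by rewrite ltr0n leq_min m0 ltnW.
have [mnB|Bmn] := ltP (minn q m)%:R (B%:R : R).
  exists (1 - mu / 2); last first.
    apply: (@walk_res_monotone _ 1) => //; first by lra.
    by move=> a; exact: one_step_res.
  split; first lra.
  apply: le_trans he1; apply: ler_pM.
  - by apply: exprn_ge0; lra.
  - exact: ltW.
  - by rewrite ler_wiXn2l ?leq_maxr//; lra.
  - exact: ltW.
(* The longest walk of at most [m] steps that does not wrap around modulo [q]. *)
pose M := minn (q.-1)./2 m.
have Mq : (M.*2 < q)%N by rewrite /M; lia.
set g := (Num.sqrt (mu * M.+1%:R))^-1.
have g0 : 0 <= g by rewrite invr_ge0 sqrtr_ge0.
exists g; last first.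
  apply: (@walk_res_monotone _ M); [lra|exact: geq_minr|].
  by move=> a; exact: short_walk_res.
split=> //.
have g2 : g ^+ 2 * (mu * M.+1%:R) = 1.
  rewrite exprVn sqr_sqrtr ?mulVf ?mulf_neq0 ?gt_eqF// mulr_ge0// ltW//.
have mnM : (minn q m)%:R <= 2 * M.+1%:R :> R.
  by rewrite -natrM ler_nat /M; lia.
have hmn : g ^+ 2 * (mu * (minn q m)%:R) <= 2.
  apply: le_trans (_ : g ^+ 2 * (mu * (2 * M.+1%:R)) <= _).
    by rewrite ler_wpM2l ?sqr_ge0// ler_wpM2l// ltW.
  have -> : g ^+ 2 * (mu * (2 * M.+1%:R)) = 2 * (g ^+ 2 * (mu * M.+1%:R)) by ring.
  by rewrite g2 mulr1.
have h4 : g ^+ 4 * (minn q m)%:R <= 1.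
  have le4 : 4 <= mu ^+ 2 * (minn q m)%:R.
    rewrite mulrC -ler_pdivrMr ?exprn_gt0//; exact: le_trans hB Bmn.
  have : (g ^+ 2 * (mu * (minn q m)%:R)) ^+ 2 <= 4.
    rewrite (_ : 4 = 2 ^+ 2); last by ring.
    by rewrite ler_pXn2r ?nnegrE// mulr_ge0 ?sqr_ge0// mulr_ge0 ?ltW.
  have -> : (g ^+ 2 * (mu * (minn q m)%:R)) ^+ 2 =
     (mu ^+ 2 * (minn q m)%:R) * (g ^+ 4 * (minn q m)%:R) by ring.
  move=> /le_trans /(_ le4); rewrite -[leRHS]mulr1 ler_pM2l//.
  by rewrite mulr_gt0 ?exprn_gt0.
have g1 : g <= 1.
  rewrite -(@ler_pXn2r _ 4)// ?nnegrE// expr1n; apply: le_trans h4.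
  by rewrite ler_peMr ?exprn_ge0// ler1n leq_min m0 ltnW.
apply: le_trans h4; apply: ler_wpM2r; first exact: ltW.
by rewrite ler_wiXn2l ?leq_maxl// g0.
Qed.

End Gain.

(** * Atoms of walks along separated chains *)

Section ChainBound.
Context {R : realType}.

Fixpoint span (V : zmodType) (m : nat) (us : seq V) (z : V) : Prop :=
  if us is u :: us' then exists2 c : int, (`|c| <= m)%N & span m us' (z - u *~ c)
  else z = 0.

Lemma span_sub (V : zmodType) k m (us : seq V) y z :
  span k us y -> span m us z -> span (k + m) us (y - z).
Proof.
elim: us y z => [|u us IH] y z /=; first by move=> -> ->; rewrite subrr.
move=> [c c1 cy] [d d1 dz]; exists (c - d); first by lia.
suff -> : y - z - u *~ (c - d) = (y - u *~ c) - (z - u *~ d) by exact: IH.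
by rewrite mulrzBr !opprB addrACA [RHS]addrACA [- z - _]addrC.
Qed.

Lemma supp_nseq (V : zmodType) (nu : R) m (u : V) (s : seq (R * V)) z :
  z \in supp (nseq m (nu, u) ++ s) ->
  exists2 c : int, (`|c| <= m)%N & z - u *~ c \in supp s.
Proof.
elim: m z => [|m IH] z /=; first by move=> zs; exists 0; rewrite ?mulr0z ?subr0.
move=> /supp_cons[c c1 /IH[d d1 h]]; exists (c + d); first by lia.
by rewrite mulrzDr opprD addrA.
Qed.

Lemma supp_rep (V : zmodType) (nu : R) m (us : seq V) z :
  z \in supp (weigh nu (rep m us)) -> span m us z.
Proof.
elim: us z => [|u us IH] z /=; first by rewrite /supp /= inE => /eqP.
rewrite /rep /= -/(rep m us) /weigh map_cat map_nseq => /supp_nseq[c c1 h].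
by exists c => //; exact: IH.
Qed.

Lemma expect_nseq (V : zmodType) (nu : R) m (u : V) f :
  expect (nseq m (nu, u)) f = expect (walk nu m) (fun c => f (u *~ c)).
Proof.
have -> : nseq m (nu, u) = [seq (p.1, u *~ p.2) | p <- walk nu m].
  by rewrite /walk map_nseq /= mulr1z.
by rewrite expect_map// => c d; rewrite mulrzBr.
Qed.

(* The order of [u] modulo the generators in the tail is a multiple of [q], as
   far as differences of walks of length [m] can detect. *)
Fixpoint separated (V : zmodType) (m : nat) (l : seq (V * nat)) : Prop :=
  if l is (u, q) :: l' then
    (forall c : int, (`|c| <= m + m)%N -> span (m + m) (map fst l') (u *~ c) ->
       (q %| `|c|)%N) /\ separated m l'
  else True.

Definition gain_exponent (mu : R) (e : nat) : Prop :=
  forall (V : zmodType) m (l : seq (V * nat)), (0 < m)%N ->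
  all (fun p => 1 < p.2)%N l -> separated m l ->
  exists2 b, 0 <= b /\ b ^+ e * (\prod_(p <- l) minn p.2 m)%:R <= 1 &
    forall a, expect (weigh (mu / 2) (rep m (map fst l))) (fun z => (z == a)%:R) <= b.

(** By induction, conditioning on the multiple [c] of the head [u]. Each conditional probability is
    at most [b], and two values of [c] that can both reach [a] differ by a multiple of [q] by
    separation. So [c] is confined to one residue class, which contributes the factor [g]. *)
Lemma gain_exponent_exists (mu : R) : 0 < mu <= 1 -> exists e, gain_exponent mu e.
Proof.
move=> mu01; have nu01 : 0 <= mu / 2 <= 1 by lra.
have [e gain] := walk_gain mu01; exists e => V m l m0.
elim: l => [|[u q] l IH] /=.
  move=> _ _; exists 1; first by rewrite big_nil expr1n mulr1.
  by move=> a /=; case: eqP.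
move=> /andP[q1 ql] [uq sl]; have [b [b0 hb] hl] := IH ql sl.
have [g [g0 hg] hw] := gain m q m0 q1.
exists (b * g).
  split; first exact: mulr_ge0.
  rewrite big_cons mulnC natrM exprMn /= mulrACA.
  by rewrite mulr_ile1 ?mulr_ge0 ?exprn_ge0.
move=> a; pose L := weigh (mu / 2) (rep m (map fst l)).
have lL : lazy L by exact: lazy_weigh.
have -> : weigh (mu / 2) (rep m (map fst ((u, q) :: l))) = nseq m (mu / 2, u) ++ L.
  by rewrite /L /rep /weigh /= map_cat map_nseq.
rewrite expect_cat expect_nseq.
pose F (c : int) := expect L (fun y => (u *~ c + y == a)%:R).
rewrite -[X in X <= _]/(expect (walk (mu / 2) m) F).
have Fb c : F c <= b.
  rewrite /F (@eq_expect _ _ _ _ (fun y => (y == a - u *~ c)%:R)) ?hl// => y.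
  by congr (_%:R); rewrite [y == _]eq_sym subr_eq eq_sym addrC.
have F0 c : F c != 0 -> span m (map fst l) (a - u *~ c).
  move=> /expect_neq0_supp[y]; case: (u *~ c + y =P a) => [<-|]; last by rewrite eqxx.
  by move=> _ /supp_rep; rewrite addrC addKr.
have lw : lazy (walk (mu / 2) m) by exact: lazy_walk.
have [/hasP[c0 sc0 Fc0]|/hasPn H] := boolP (has (fun c => F c != 0) (supp (walk (mu / 2) m))).
  apply: le_trans (_ : expect (walk (mu / 2) m) (fun c => b * (res q c0 c)%:R) <= _); last first.
    by rewrite expectZ ler_wpM2l.
  apply: le_expect_supp => // c sc.
  case: (eqVneq (F c) 0) => [->|Fc]; first by rewrite mulr_ge0// ler0n.
  suff -> : res q c0 c by rewrite mulr1.
  rewrite /res dvdzE /=; apply: uq.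
    have h1 := supp_walk sc; have h2 := supp_walk sc0.
    by clear -h1 h2; lia.
  have <- : (a - u *~ c0) - (a - u *~ c) = u *~ (c - c0).
    by rewrite mulrzBr opprB addrC addrA subrK.
  exact: span_sub (F0 _ Fc0) (F0 _ Fc).
apply: le_trans (_ : 0 <= _); last exact: mulr_ge0.
rewrite -[leRHS](expect_cst (walk (mu / 2) m)); apply: le_expect_supp => // c /H.
by rewrite negbK => /eqP ->.
Qed.

End ChainBound.

Lemma absz_leD (a b : int) k l :
  (`|a| <= k)%N -> (`|b| <= l)%N -> (`|(a + b)%R| <= k + l)%N.
Proof. lia. Qed.

(** * Integer lattices built up one generator at a time *)

Section Lattice.
Variables (n : nat) (L : int) (us : seq 'I_n).
Implicit Types (z h : {ffun 'I_n -> int}) (hs : seq {ffun 'I_n -> int}).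

(** The lattice generated by [hs] over the base lattice $L\mathbb{Z}^{us}$; coordinates outside [us]
    are left free. *)
Fixpoint lat hs z : Prop :=
  if hs is h :: hs' then exists c : int, lat hs' (z - h *~ c)
  else {in us, forall j, (L %| z j)%Z}.

Lemma lat_sub hs y z : lat hs y -> lat hs z -> lat hs (y - z).
Proof.
elim: hs y z => [|h hs IH] y z /=.
  by move=> Hy Hz j ju; rewrite !ffunE rpredB ?Hy ?Hz.
move=> [c cy] [d dz]; exists (c - d).
suff -> : y - z - h *~ (c - d) = (y - h *~ c) - (z - h *~ d) by exact: IH.
by rewrite mulrzBr !opprB addrACA [RHS]addrACA [- z - _]addrC.
Qed.

Lemma lat_base hs z : {in us, forall j, (L %| z j)%Z} -> lat hs z.
Proof.
by elim: hs z => [//|h hs IH] z Hz /=; exists 0; rewrite mulr0z subr0; exact: IH.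
Qed.

Lemma lat0 hs : lat hs 0.
Proof. by apply: lat_base => j _; rewrite ffunE dvdz0. Qed.

Lemma latN hs z : lat hs z -> lat hs (- z).
Proof. by move=> hz; rewrite -sub0r; apply: lat_sub => //; exact: lat0. Qed.

Lemma latD hs y z : lat hs y -> lat hs z -> lat hs (y + z).
Proof. by move=> hy /latN hz; rewrite -[z]opprK; exact: lat_sub. Qed.

Lemma latMn hs z k : lat hs z -> lat hs (z *+ k).
Proof.
move=> hz; elim: k => [|k IH]; first by rewrite mulr0n; exact: lat0.
by rewrite mulrS; exact: latD.
Qed.

Lemma latMz hs z c : lat hs z -> lat hs (z *~ c).
Proof.
case: c => k hz; first exact: latMn.
by rewrite NegzE mulrNz; apply: latN; exact: latMn.
Qed.

(** Take the least positive [q]; a nonzero remainder of [c] modulo [q] would be a smaller one. *)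
Lemma lat_order hs z s : (0 < s)%N -> lat hs (z *+ s) ->
  exists q, [/\ (0 < q <= s)%N, lat hs (z *+ q) &
    forall c : int, lat hs (z *~ c) -> (q %| `|c|)%N].
Proof.
move=> s0 hs_s.
have ex : exists q, (0 < q)%N && `[< lat hs (z *+ q) >].
  by exists s; rewrite s0; apply/asboolP.
case: (ex_minnP ex) => q /andP[q0 /asboolP hq] qmin; exists q; split => //.
  by rewrite q0 qmin// s0; apply/asboolP.
move=> c hc; rewrite -[q in (q %| _)%N]/(`|q%:Z|%N) -dvdzE.
apply/dvdz_mod0P.
have r0 : 0 <= (c %% q)%Z by rewrite modz_ge0//; lia.
have rq : (c %% q)%Z < q by rewrite ltz_pmod//; lia.
have hr : lat hs (z *~ (c %% q)%Z).
  have -> : (c %% q)%Z = c - q%:Z * (c %/ q)%Z.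
    by apply/eqP; rewrite eq_sym subr_eq addrC mulrC -divz_eq.
  rewrite mulrzBr; apply: lat_sub => //.
  by rewrite mulrzA; apply: latMz.
case: (c %% q)%Z r0 rq hr => // -[//|r] _ rq hr.
have /qmin : (0 < r.+1)%N && `[< lat hs (z *+ r.+1) >] by apply/asboolP.
by clear -rq; lia.
Qed.

End Lattice.

(** * The two greedy stages of the linear inverse theorem *)

Section InverseTheorem.
Context {R : realType}.
Variables (n : nat) (v : 'I_n -> R).

Definition comb (us : seq 'I_n) (c : 'I_n -> int) : R := \sum_(i <- us) v i *~ c i.

Lemma eq_comb us c d : {in us, c =1 d} -> comb us c = comb us d.
Proof. by move=> cd; apply: eq_big_seq => i /cd ->. Qed.

Lemma combB us (c d : {ffun 'I_n -> int}) : comb us (c - d) = comb us c - comb us d.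
Proof. by rewrite /comb -sumrB; apply: eq_bigr => i _; rewrite !ffunE mulrzBr. Qed.

Lemma combD us (c d : {ffun 'I_n -> int}) : comb us (c + d) = comb us c + comb us d.
Proof. by rewrite /comb -big_split; apply: eq_bigr => i _; rewrite !ffunE mulrzDr. Qed.

Lemma comb_scale us c k : comb us (fun i => k * c i) = comb us c *~ k.
Proof. by rewrite /comb mulrz_suml; apply: eq_bigr => i _; rewrite mulrC mulrzA. Qed.

Lemma comb_span m us c : (forall i, (`|c i| <= m)%N) -> span m (map v us) (comb us c).
Proof.
move=> cm; elim: us => [|u us IH] /=; first by rewrite /comb big_nil.
by exists (c u); rewrite // /comb big_cons addrC addKr.
Qed.

Lemma span_mono k m (us : seq R) z : (k <= m)%N -> span k us z -> span m us z.
Proof.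
move=> km; elim: us z => [//|u us IH] z /= [c ck h].
by exists c; [exact: leq_trans ck km | exact: IH].
Qed.

Lemma span_comb m us z : uniq us -> span m (map v us) z ->
  exists2 c : {ffun 'I_n -> int}, (forall i, (`|c i| <= m)%N) & z = comb us c.
Proof.
elim: us z => [|u us IH] z /=.
  move=> _ ->; exists 0; first by move=> i; rewrite ffunE.
  by rewrite /comb big_nil.
move=> /andP[uus uq] [k km /(IH _ uq)[c cm e]].
exists [ffun i => if i == u then k else c i] => [i|].
  by rewrite ffunE; case: eqP.
rewrite /comb big_cons ffunE eqxx -[LHS](subrK (v u *~ k)) e addrC; congr (_ + _).
apply: eq_big_seq => i ius; rewrite ffunE; case: eqP => // iu.
by rewrite -iu ius in uus.
Qed.

(** The scale depends on the number of indices already chosen; [N] will be decreasing, so later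
    choices are tested at smaller scales. *)
Definition bad1 (N : nat -> nat) (us : seq 'I_n) (i : 'I_n) : bool :=
  `[< forall c : int, c != 0 -> (`|c| <= N (size us).+1)%N ->
      ~ span (N (size us).+1) (map v us) (v i *~ c) >].

(** The head was tested at exactly the scale [N (size us)], so its coefficient must vanish; the tail
    was tested at larger scales. *)
Lemma chain_dissociated N us c : (forall k, N k.+1 <= N k)%N ->
  chain (bad1 N) us -> (forall i, (`|c i| <= N (size us))%N) -> comb us c = 0 ->
  {in us, forall i, c i = 0}.
Proof.
move=> NS; elim: us => [//|u us IH] /= /andP[/asboolP bu ch] cN.
rewrite /comb big_cons -/(comb us c) => e0.
have cu : c u = 0.
  apply/eqP/negPn/negP => cu; apply: (bu (c u)) => //.
  have -> : v u *~ c u = comb us (fun i => -1 * c i).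
    by rewrite comb_scale mulrN1z; apply/eqP; rewrite -addr_eq0 e0.
  by apply: comb_span => i; rewrite mulN1r abszN; exact: cN.
move=> i; rewrite inE => /orP[/eqP -> //|]; apply: IH => // [j|].
  exact: leq_trans (cN j) (NS _).
by move: e0; rewrite cu mulr0z add0r.
Qed.

(** At these scales only [c = 0] gives a relation, so [m] can serve as the order of every
    element. *)
Lemma chain_separated N us m : (forall k, m + m <= N k)%N ->
  chain (bad1 N) us -> separated m [seq (v i, m) | i <- us].
Proof.
move=> mN; elim: us => [//|u us IH] /= /andP[/asboolP bu ch]; split; last exact: IH.
move=> c cm hc; case: (eqVneq c 0) => [->|c0]; first by rewrite dvdn0.
exfalso; apply: (bu c c0); first exact: leq_trans cm (mN _).
by apply: span_mono (mN _) _; rewrite -map_comp in hc.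
Qed.

Lemma not_bad1 N us i : uniq us -> ~~ bad1 N us i ->
  exists s (c : 'I_n -> int), [/\ (0 < s <= N (size us).+1)%N,
    forall j, (`|c j| <= N (size us).+1)%N & v i *+ s = comb us c].
Proof.
move=> uq /asboolPn/existsNP[s /not_implyP[s0 /not_implyP[sN /contrapT]]].
move=> /(span_comb uq)[c cN e].
(* The sign of the multiplier is moved to the coefficients. *)
exists `|s|%N, (fun j => Num.sg s * c j); split => [|j|].
- by rewrite sN lt0n absz_eq0 s0.
- by rewrite abszM absz_sg s0 mul1n.
- by rewrite comb_scale -e -mulrzA mulrC -normrEsg -abszE pmulrn.
Qed.

(** Discarding the steps from [rest] and [us1] can only increase the largest atom. So [sigma] is at
    most the chain bound [b], and the hypothesis on [X] limits the product. *)
Lemma separated_prod_le (mu : R) e m (sigma : R) X rest us1 us2 (l : seq (R * nat)) :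
  0 < mu <= 1 -> gain_exponent mu e -> (0 < m)%N -> 0 <= sigma ->
  1 <= sigma ^+ e * X%:R ->
  sigma <= prob0 (let k := [seq (mu, v i) | i <- rest ++ rep m (us1 ++ us2)] in k ++ k) ->
  map fst l = map v us2 -> all (fun p => 1 < p.2)%N l -> separated m l ->
  (\prod_(p <- l) minn p.2 m <= X)%N.
Proof.
move=> mu01 He m0 s0 sX sle lus lq lsep.
have [b [b0 hb] hl] := He _ _ _ m0 lq lsep.
have sb : sigma <= b.
  apply: le_trans sle _.
  have -> : [seq (mu, v i) | i <- rest ++ rep m (us1 ++ us2)] =
      weigh mu (map v (rest ++ rep m us1) ++ rep m (map v us2)).
    by rewrite /weigh rep_cat catA map_cat [RHS]map_cat -!map_comp -map_rep -map_comp.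
  apply: le_trans (prob0_double_le _ _) _; first by lra.
  rewrite /weigh map_cat -/(weigh _ _) /prob0 -lus.
  apply: (@expect_le_sup _ _ _ _ (fun a z => z == a)) => [a x z||a].
  - by rewrite [z == _]eq_sym subr_eq eq_sym addrC.
  - by apply: lazy_weigh; lra.
  - exact: hl.
rewrite -(ler_nat R); set P := (_%:R : R).
have P0 : 0 <= P by rewrite ler0n.
have : sigma ^+ e * P <= 1.
  by apply: le_trans hb; rewrite ler_wpM2r// lerXn2r ?nnegrE.
have X0 : 0 <= X%:R :> R by rewrite ler0n.
move=> h; apply: le_trans (_ : P * (sigma ^+ e * X%:R) <= _).
  by rewrite ler_peMr.
by rewrite mulrA [P * _]mulrC ler_piMl.
Qed.

(* The rational coordinates [c_j / s] of [v i] are multiplied by [M`!], which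
   clears all denominators [s <= M] at once; the size of [M`!] is irrelevant, as
   it cancels against the base lattice [M`! Z^us]. *)
Lemma formal_coordinates N us : uniq us ->
  exists hat : 'I_n -> {ffun 'I_n -> int}, forall i, ~~ bad1 N us i ->
  let M := N (size us).+1 in
  [/\ comb us (hat i) = v i *+ M`!, forall j, (`|hat i j| <= M * M`!)%N &
      exists2 s, (0 < s <= M)%N & forall hs, lat M`!%:Z us hs (hat i *+ s)].
Proof.
move=> uq; set M := N _.
suff H i : exists h : {ffun 'I_n -> int}, ~~ bad1 N us i ->
    [/\ comb us h = v i *+ M`!, forall j, (`|h j| <= M * M`!)%N &
      exists2 s, (0 < s <= M)%N & forall hs, lat M`!%:Z us hs (h *+ s)].
  by have [hat hatP] := choice H; exists hat.
case: (boolP (bad1 N us i)) => [_|nb]; first by exists 0.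
have [s [c [sM cM e]]] := not_bad1 uq nb; rewrite -/M in sM cM.
have sdvd : (s %| M`!)%N by apply: dvdn_fact.
have [s0 _] := andP sM.
exists [ffun j => (M`! %/ s)%:Z * c j] => _; split => [|j|].
- rewrite (@eq_comb _ _ (fun j => (M`! %/ s)%:Z * c j)); last by move=> j _; rewrite ffunE.
  by rewrite comb_scale -e -pmulrn -mulrnA mulnC divnK.
- by rewrite ffunE abszM mulnC leq_mul// leq_div.
- exists s => // hs; apply: lat_base => j _.
  have -> : ([ffun j => (M`! %/ s)%:Z * c j] *+ s : {ffun 'I_n -> int}) j = M`!%:Z * c j.
    by rewrite ffunMnE ffunE -mulrnAl -[X in X * _]mulr_natr natz -PoszM divnK.
  by rewrite dvdz_mulr.
Qed.

(** Lifts a short combination of real coefficients to formal vectors, so that a real relation can be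
    tested in the lattice. *)
Lemma span_lift (L M : nat) us (hat : 'I_n -> {ffun 'I_n -> int}) B us2 y :
  {in us2, forall i, comb us (hat i) = v i *+ L /\ forall j, (`|hat i j| <= B)%N} ->
  span M (map v us2) y ->
  exists z, [/\ lat L us (map hat us2) z, comb us z = y *+ L &
    forall j, (`|z j| <= size us2 * (M * B))%N].
Proof.
elim: us2 y => [|u us2 IH] y Hh /=.
  move=> ->; exists 0; split => [|| j]; rewrite ?mul0rn.
  - by move=> j _; rewrite ffunE dvdz0.
  - by rewrite /comb big1// => i _; rewrite ffunE mulr0z.
  - by rewrite ffunE.
move=> [c cM /IH[|z [zl ze zB]]]; first by move=> i ius; apply: Hh; rewrite inE ius orbT.
have [hu hB] := Hh u (mem_head _ _).
exists (hat u *~ c + z); split => [||j].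
- by exists c; rewrite addrC addKr.
- rewrite combD ze mulrnBl; have -> : comb us (hat u *~ c) = (v u *~ c) *+ L.
    rewrite (@eq_comb _ _ (fun j => c * hat u j)); last first.
      by move=> j _; rewrite ffunMzE mulrC mulrzz.
    by rewrite comb_scale hu !pmulrn -!mulrzA mulrC.
  by rewrite addrC subrK.
- rewrite ffunE ffunMzE mulrzz mulSn.
  have h1 : (`|(hat u j * c)%R| <= M * B)%N by rewrite abszM mulnC leq_mul.
  exact: absz_leD h1 (zB j).
Qed.

(* One elimination step: a new lattice generator [h] of order [q] over the
   lattice spanned so far contributes the factor [q] to the index [D]. *)
Lemma lat_index_step (L : int) us hs (h : {ffun 'I_n -> int}) q D z :
  lat L us hs (h *+ q) ->
  (forall y, lat L us hs y -> {in us, forall j, (L %| y j *+ D)%Z}) ->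
  lat L us (h :: hs) z -> {in us, forall j, (L %| z j *+ (q * D))%Z}.
Proof.
move=> hq HD [c hz] j ju.
have : lat L us hs (z *+ q).
  rewrite -(subrK (h *~ c *+ q) (z *+ q)) -mulrnBl; apply: latD; first exact: latMn.
  by rewrite pmulrn -mulrzA mulrC mulrzA -pmulrn; apply: latMz.
by move=> /HD/(_ j ju); rewrite ffunMnE mulrnA.
Qed.

Definition bad2 (N : nat -> nat) us (hat : 'I_n -> {ffun 'I_n -> int})
    (us2 : seq 'I_n) (i : 'I_n) : bool :=
  ~~ bad1 N us i && ~~ `[< lat (N (size us).+1)`!%:Z us (map hat us2) (hat i) >].

(** Capping orders at [m] costs at most a power [f], since every order is at most $m^f$. *)
Lemma prod_le_minn_pow (l : seq (R * nat)) M m f : (0 < f)%N -> (M <= m ^ f)%N ->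
  all (fun p => 1 < p.2 <= M)%N l ->
  (\prod_(p <- l) p.2 <= (\prod_(p <- l) minn p.2 m) ^ f)%N.
Proof.
move=> f0 Mf; elim: l => [|[u q] l IH] /=; first by rewrite !big_nil exp1n.
move=> /andP[/andP[q1 qM] ql]; rewrite !big_cons expnMn leq_mul ?IH//=.
have [qm|mq] := leqP q m; last exact: leq_trans Mf.
by rewrite -[leqLHS]expn1 leq_pexp2l// ltnW.
Qed.

(** The orders are defined formally, modulo the lattice, while [separated] speaks of real relations.
    The point is that a short real relation among the second-stage elements is already a formal one,
    by dissociation of [us] at the larger scale [N (size us)]. *)
Lemma chain_lattice N us (hat : 'I_n -> {ffun 'I_n -> int}) m X f us2 :
  (forall k, N k.+1 <= N k)%N -> chain (bad1 N) us ->
  (forall i, ~~ bad1 N us i -> let M := N (size us).+1 in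
    [/\ comb us (hat i) = v i *+ M`!, forall j, (`|hat i j| <= M * M`!)%N &
      exists2 s, (0 < s <= M)%N & forall hs, lat M`!%:Z us hs (hat i *+ s)]) ->
  (0 < f)%N -> (N (size us).+1 <= m ^ f)%N ->
  let M := N (size us).+1 in
  (X ^ f * M * (m + m) * M * (size us2).+1 <= N (size us))%N ->
  (forall t (l : seq (R * nat)), suffix t us2 -> map fst l = map v t ->
     all (fun p => 1 < p.2)%N l -> separated m l -> (\prod_(p <- l) minn p.2 m <= X)%N) ->
  chain (bad2 N us hat) us2 ->
  exists l : seq (R * nat), [/\ map fst l = map v us2,
    all (fun p => 1 < p.2 <= M)%N l, separated m l &
    forall z, lat M`!%:Z us (map hat us2) z ->
      {in us, forall j, (M`!%:Z %| z j *+ \prod_(p <- l) p.2)%Z}].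
Proof.
move=> NS ch1 hatP f0 Mf M; elim: us2 => [|u us2 IH] hN Hprod /=.
  move=> _; exists [::]; split => // z hz j ju; rewrite big_nil mulr1n.
  exact: hz.
move=> /andP[/andP[gu /asboolP bu] ch2].
have {IH}[||l [lus lq lsep HD]] := IH _ _ ch2.
- apply: leq_trans hN; rewrite leq_mul2l; apply/orP; right => /=; lia.
- by move=> t l st; apply: Hprod; apply: suffix_trans st (suffix_cons _ _).
have lq1 : all (fun p => 1 < p.2)%N l.
  by apply: sub_all lq => p /andP[].
have DX : (\prod_(p <- l) p.2 <= X ^ f)%N.
  apply: leq_trans (prod_le_minn_pow f0 Mf lq) _; rewrite leq_exp2r//.
  by apply: (Hprod us2) => //; exact: suffix_cons.
set D := (\prod_(p <- l) p.2)%N in DX HD.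
have D0 : (0 < D)%N.
  rewrite /D big_seq prodn_cond_gt0// => p pl.
  by apply: ltnW; exact: (allP lq1).
have [hu hB [s sM hs]] := hatP _ gu.
have [s0 sM'] := andP sM.
have [q [q0 hq hqc]] := lat_order s0 (hs (map hat us2)).
have q1 : (1 < q)%N.
  by case: q q0 hq {hqc} => [//|[|//]] _; rewrite mulr1n.
have qM : (q <= M)%N by have /andP[_ ?] := q0; exact: leq_trans sM'.
have good2 : {in us2, forall i, ~~ bad1 N us i}.
  move=> i; elim: us2 ch2 {hN Hprod bu hs HD lus hq hqc} => [//|w us2 IH] /= /andP[/andP[gw _] ch].
  by rewrite inE => /orP[/eqP -> //|]; exact: IH.
exists ((v u, q) :: l); split.
- by rewrite /= lus.
- by rewrite /= q1 qM.
- split=> // c cm; rewrite lus => hc; apply: hqc.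
  have [|z [zl ze zB]] := @span_lift M`! (m + m) us hat (M * M`!) us2 (v u *~ c) _ hc.
    by move=> i /good2 /hatP[].
  (* The discrepancy between the real relation and its formal lift: it represents the real number
     0. *)
  pose w := hat u *~ c - z.
  have w0 : comb us w = 0.
    rewrite combB ze.
    rewrite (@eq_comb _ (hat u *~ c) (fun j => c * hat u j)); last first.
      by move=> j _; rewrite ffunMzE mulrC mulrzz.
    by rewrite comb_scale hu !pmulrn -!mulrzA [c * _]mulrC subrr.
  have wl : {in us, forall j, (M`!%:Z %| w j *+ (q * D))%Z}.
    apply: (lat_index_step hq HD); exists c.
    by rewrite /w addrC addKr; exact: latN.
  have F0 : (0 < M`!)%N by exact: fact_gt0.
  (* Multiplication by the index [q * D] makes [w] divisible by the factorial. After division the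
     coefficients are small enough for [chain_dissociated], so [w] vanishes on [us]. *)
  pose w' j : int := if j \in us then (w j *+ (q * D) %/ M`!%:Z)%Z else 0.
  have w'E j : j \in us -> w' j * M`!%:Z = w j *+ (q * D).
    by move=> ju; rewrite /w' ju divzK// wl.
  have w'0 : {in us, forall j, w' j = 0}.
    apply: (chain_dissociated NS ch1) => [j|].
      case: (boolP (j \in us)) => ju; last by rewrite /w' (negbTE ju).
      have wj : (`|w j| <= (m + m) * (M * M`!) * (size us2).+1)%N.
        have h1 : (`|(hat u j * c)%R| <= (m + m) * (M * M`!))%N.
          by rewrite abszM mulnC leq_mul.
        rewrite /w !ffunE ffunMzE mulrzz mulnS; apply: absz_leD => //.
        by rewrite abszN mulnC.
      rewrite -(leq_pmul2r F0) -[X in (_ * X)%N]/(`|M`!%:Z|%N) -abszM w'E//.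
      rewrite -mulr_natr abszM natz /=.
      apply: leq_trans (leq_mul wj (leq_mul qM DX)) _.
      apply: leq_trans (leq_mul hN (leqnn M`!)).
      have E (a b r d g : nat) :
          (a * (b * r) * d * (b * g) = g * b * a * b * d * r)%N by clear; lia.
      by rewrite E leq_mul2r leq_mul2l leqnSn !orbT.
    suff : comb us w' *~ M`!%:Z = 0.
      by move/eqP; rewrite mulrz_eq0 => /orP[/eqP|/eqP //]; clear -F0; lia.
    rewrite -comb_scale (@eq_comb _ _ (fun j => (q * D)%:Z * w j)).
      by rewrite comb_scale w0 mul0rz.
    by move=> j ju; rewrite mulrC w'E// -mulr_natl natz.
  have wz : hat u *~ c = w + z by rewrite /w subrK.
  rewrite wz; apply: latD => //; apply: lat_base => j ju.
  have := w'E j ju; rewrite w'0// mul0r => /esym/eqP.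
  have qD0 : (0 < q * D)%N by rewrite muln_gt0 D0 andbT; exact: ltnW.
  by rewrite mulrn_eq0 eqn0Ngt qD0 => /eqP ->; rewrite dvdz0.
- by move=> z hz j ju; rewrite big_cons; exact: (lat_index_step hq HD hz).
Qed.

(** The first stage picks at most [T0] generators, since each contributes a factor [m] to a product
    bounded by [X]. In the second stage each order is at least 2, so fewer than [T2] elements are
    picked. The product of the orders is the common denominator. *)
Lemma inverse_theorem_bounds (mu : R) e (sigma : R) X T0 T2 t N fs :
  0 < mu <= 1 -> gain_exponent mu e -> 0 <= sigma -> 1 <= sigma ^+ e * X%:R ->
  (0 < t)%N -> let m := (2 ^ t)%N in
  (X < m ^ T0.+1)%N -> (X < 2 ^ T2)%N ->
  (forall k, N k.+1 <= N k)%N -> (forall k, m + m <= N k)%N ->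
  (forall d, (d <= T0)%N -> [/\ 0 < fs d, N d.+1 <= m ^ fs d &
     X ^ fs d * N d.+1 * (m + m) * N d.+1 * T2.+1 <= N d]%N) ->
  sigma <= prob0 (let s := [seq (mu, v i) | i <- enum 'I_n] in s ++ s) ->
  exists (us : seq 'I_n) D (J : {set 'I_n}),
    [/\ (size us <= T0)%N, (0 < D <= N 0%N)%N,
        (n <= #|J| + m * (T0 + T2 + 2))%N &
     forall j, j \in J -> exists2 c : 'I_n -> int,
       (forall i, `|c i| <= N 0%N)%N & v j *+ D = comb us c].
Proof.
move=> mu01 He s0 sX t0 m XT0 XT2 NS mN hfs sle.
have m1 : (1 < m)%N by rewrite -[1%N]/(2 ^ 0)%N ltn_exp2l.
have m0 : (0 < m)%N by exact: ltnW.
have N0 d : (N d <= N 0)%N by elim: d => // d IH; exact: leq_trans (NS d) IH.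
have prodX us rest us1 us2 (l : seq (R * nat)) : us = us1 ++ us2 ->
    sigma <= prob0 (let k := [seq (mu, v i) | i <- rest ++ rep m us] in k ++ k) ->
    map fst l = map v us2 -> all (fun p => 1 < p.2)%N l -> separated m l ->
    (\prod_(p <- l) minn p.2 m <= X)%N.
  by move=> -> hs; exact: separated_prod_le sX hs.
have uE : uniq (enum 'I_n) by exact: enum_uniq.
have [us [rest [[uq _ sz ch sus] alt]]] :=
  greedy_choice (bad1 N) t uE sle T0.+1.
have usX : (m ^ size us <= X)%N.
  have <- : (\prod_(p <- [seq (v i, m) | i <- us]) minn p.2 m = m ^ size us)%N.
    rewrite big_map; elim: (us) => [|u r IH]; first by rewrite big_nil.
    by rewrite big_cons IH /= minnn expnS.
  apply: (@prodX us rest [::] us) => //.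
  - by rewrite -map_comp.
  - by apply/allP => p /mapP[i _ ->].
  - exact: chain_separated.
have {alt} [szT cnt] : (size us < T0.+1)%N /\ (count (bad1 N us) rest < m)%N.
  case: alt => [e1|//]; move: usX; rewrite e1 leqNgt XT0 //.
have uus : uniq us by move: uq; rewrite cat_uniq => /andP[].
have [hat hatP] := formal_coordinates N uus.
have [fd0 NM hN] := hfs _ szT.
(* The second stage starts afresh from all indices, with the generators [us] kept as coordinates
   only. *)
have [us2 [rest2 [[uq2 _ sz2 ch2 sus2] alt2]]] :=
  greedy_choice (bad2 N us hat) t uE sle T2.
have szle2 : (size us2 <= T2)%N by case: alt2 => [->//|[/ltnW]].
set M := N (size us).+1 in NM hN hatP.
have [|t' l st|l [lus lq lsep HD]] :=
  @chain_lattice N us hat m X (fs (size us)) us2 NS ch hatP fd0 NM _ _ ch2.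
- by apply: leq_trans hN; rewrite leq_mul2l ltnS szle2 orbT.
- by have /suffixP[us1 e1] := st; apply: (prodX us2 rest2 us1).
have lq1 : all (fun p => 1 < p.2)%N l by apply: sub_all lq => p /andP[].
have minX : (\prod_(p <- l) minn p.2 m <= X)%N by apply: (prodX us2 rest2 [::] us2).
have cnt2 : (count (bad2 N us hat us2) rest2 < m)%N.
  case: alt2 => [e2|[]//]; move: minX; rewrite leqNgt (leq_trans XT2)// -e2.
  have -> : size us2 = size l by rewrite -(size_map fst) lus size_map.
  elim: (l) lq1 => [|p l' IH] /=; first by rewrite big_nil.
  by move=> /andP[p1 /IH h]; rewrite big_cons expnS leq_mul// leq_min p1.
set D := (\prod_(p <- l) p.2)%N in HD.
have D0 : (0 < D)%N.
  rewrite /D big_seq prodn_cond_gt0// => p pl.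
  by apply: ltnW; exact: (allP lq1).
have DX : (D <= X ^ fs (size us))%N.
  by apply: leq_trans (prod_le_minn_pow fd0 NM lq) _; rewrite leq_exp2r.
have M0 : (0 < M)%N by apply: leq_trans (mN _); rewrite addn_gt0 m0.
have DMN : (D * M <= N 0%N)%N.
  apply: leq_trans (N0 (size us)); apply: leq_trans hN.
  rewrite -!mulnA leq_mul// leq_pmulr// !muln_gt0 addn_gt0 m0 M0//.
pose J := [set j in rest2 | ~~ bad1 N us j & ~~ bad2 N us hat us2 j].
exists us, D, J; split => //.
- by rewrite D0 (leq_trans _ DMN)// leq_pmulr.
(* Each stage loses the blocks it consumed and fewer than [m] remaining bad indices. *)
- pose A := [set j | ~~ bad1 N us j].
  pose B := [set j in rest2 | ~~ bad2 N us hat us2 j].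
  have cardge (P : pred 'I_n) (r : seq 'I_n) (S : {set 'I_n}) : uniq r ->
      {in r, forall j, ~~ P j -> j \in S} -> (size r <= #|S| + count P r)%N.
    move=> ur rS; rewrite -(count_predC P r) addnC leq_add2r -size_filter.
    have /card_uniqP <- : uniq [seq j <- r | predC P j] by exact: filter_uniq.
    apply/subset_leq_card/fintype.subsetP => j; rewrite mem_filter => /andP[/= Pj jr].
    exact: rS.
  have nA : (n <= #|A| + m * (T0 + 1))%N.
    have : (size rest <= #|A| + count (bad1 N us) rest)%N.
      apply: cardge => [|j _ nb]; last by rewrite inE.
      by move: uq; rewrite cat_uniq => /and3P[].
    have : (m * size us <= m * T0)%N by rewrite leq_mul2l -ltnS szT orbT.
    have := sz; rewrite size_enum_ord -/m => h1 h2 h3.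
    by rewrite mulnDr muln1; clear -h1 h2 h3 cnt; lia.
  have nB : (n <= #|B| + m * (T2 + 1))%N.
    have : (size rest2 <= #|B| + count (bad2 N us hat us2) rest2)%N.
      apply: cardge => [|j jr nb]; last by rewrite inE jr nb.
      by move: uq2; rewrite cat_uniq => /and3P[].
    have : (m * size us2 <= m * T2)%N by rewrite leq_mul2l szle2 orbT.
    have := sz2; rewrite size_enum_ord -/m => h1 h2 h3.
    by rewrite mulnDr muln1; clear -h1 h2 h3 cnt2; lia.
  have -> : J = A :&: B by apply/setP => j; rewrite !inE andbCA.
  have h1 := cardsUI A B.
  have h2 : (#|A :|: B| <= n)%N by rewrite -[X in (_ <= X)%N]card_ord max_card.
  have -> : (m * (T0 + T2 + 2) = m * (T0 + 1) + m * (T2 + 1))%N by clear; lia.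
  have E (a b p q x y : nat) : (p + q = a + b -> p <= n -> n <= a + x -> n <= b + y ->
    n <= q + (x + y))%N by clear; lia.
  exact: E h1 h2 nA nB.
- move=> j; rewrite inE => /and3P[_ g1 g2].
  have [hj hB _] := hatP _ g1.
  have hl : lat M`!%:Z us (map hat us2) (hat j).
    by move: g2; rewrite /bad2 g1 /= negbK => /asboolP.
  have hd := HD _ hl.
  pose c' i : int := if i \in us then (hat j i *+ D %/ M`!%:Z)%Z else 0.
  have c'E i : i \in us -> c' i * M`!%:Z = hat j i *+ D.
    by move=> iu; rewrite /c' iu divzK// hd.
  have F0 : (0 < M`!)%N by exact: fact_gt0.
  exists c' => [i|].
    case: (boolP (i \in us)) => iu; last by rewrite /c' (negbTE iu).
    apply: leq_trans DMN; rewrite -(leq_pmul2r F0).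
    rewrite -[X in (_ * X <= _)%N]/(`|M`!%:Z|%N) -abszM c'E//.
    by rewrite -mulr_natr abszM natz /= mulnC -mulnA leq_mul.
  (* The factorial introduced by [formal_coordinates] cancels here. *)
  apply: (@mulIr _ (M`!%:R)); first by rewrite unitfE pnatr_eq0 -lt0n.
  rewrite !mulr_natr -mulrnA mulnC mulrnA -hj [RHS]pmulrn -comb_scale pmulrn -comb_scale.
  by apply: eq_comb => i iu; rewrite [RHS]mulrC c'E// -mulr_natl natz.
Qed.

End InverseTheorem.

(** * Powers of logarithms against powers *)

Lemma linear_le_exp2 a b l : (4 * (a + b) <= l)%N -> (a * l + b <= 2 ^ l)%N.
Proof.
move=> hl; pose h := (l./2)%N.
have hh : (2 * (a + b) <= 2 ^ h)%N.
  by apply: leq_trans (ltnW (ltn_expl h (leqnn 2))); rewrite /h; lia.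
have l1 : (l.+1 <= 2 * 2 ^ h)%N.
  by have := ltn_expl h (leqnn 2); rewrite /h; lia.
apply: leq_trans (_ : (a + b) * l.+1 <= _)%N; first by nia.
apply: leq_trans (leq_mul (leqnn _) l1) _.
rewrite mulnA [((a + b) * 2)%N]mulnC; apply: leq_trans (leq_mul hh (leqnn _)) _.
by rewrite -expnD leq_exp2l//; rewrite /h; lia.
Qed.

(** Used with [L] the binary logarithm of [n], to absorb the logarithmic number of second-stage
    rounds. *)
Lemma polylog_le_exp2 a b g : (0 < g)%N ->
  exists L0, forall L, (L0 <= L)%N -> ((a * L + b) ^ g <= 2 ^ L)%N.
Proof.
move=> g0; exists (g * (4 * (a * g + (a * g + b)))).+1 => L hL.
pose l := (L %/ g)%N.
have lL : (l * g <= L)%N by exact: leq_trunc_div.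
have Ll : (L < l.+1 * g)%N by exact: ltn_ceil.
apply: leq_trans (_ : (2 ^ l) ^ g <= _)%N; last by rewrite -expnM leq_exp2l.
rewrite leq_exp2r//; apply: leq_trans (_ : a * g * l + (a * g + b) <= _)%N.
  by nia.
by apply: linear_le_exp2; rewrite /l leq_divRL// mulnC ltnW.
Qed.

Lemma expn_le a b k : (a <= b)%N -> (a ^ k <= b ^ k)%N.
Proof. by case: k => // k ab; rewrite leq_exp2r. Qed.

(** * Choice of parameters in the linear inverse theorem *)

Section InverseLittlewoodOfford.
Context {R : realType}.

Lemma inverse_littlewood_offord_nat (mu : R) (c g : nat) : 0 < mu <= 1 -> (1 < g)%N ->
  exists K n0 : nat, forall n, (n0 <= n)%N -> forall (v : 'I_n -> R) (a : R),
    1 <= expect [seq (mu, v i) | i <- enum 'I_n] (fun z => (z == a)%:R) * n%:R ^+ c ->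
  exists (us : {ffun 'I_K -> 'I_n}) (D Y : nat) (J : {set 'I_n}),
    [/\ (0 < D <= n ^ K)%N, (n <= #|J| + Y)%N, (Y ^ g <= n ^ 2)%N &
     forall j, j \in J -> exists2 k : {ffun 'I_K -> int},
       (forall h, `|k h| <= n ^ K)%N & v j *+ D = \sum_(h < K) v (us h) *~ k h].
Proof.
move=> mu01 g1; have g0 : (0 < g)%N by exact: ltnW.
have [e He] := gain_exponent_exists mu01.
(* With [sigma] the square of the atom, [X] can be $n^{ce}$. Since [m] is about $n^{1/g}$, one has
   $n\le m^f$, which makes [T0] rounds enough. *)
pose ce := (2 * c * e)%N; pose f := (2 * g)%N; pose T0 := (f * ce)%N.
(* The scales are $N_d=n^{E_d}$; [G] is the growth of exponents that [chain_lattice] demands between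
   consecutive scales. *)
pose G x := ((ce * f + 2) * x + 2)%N; pose E k := iter (T0.+1 - k) G 1%N.
have [L0 HL0] := polylog_le_exp2 ce (ce + T0 + 3) g0.
pose K := (T0 + E 0%N).+1.
exists K, (2 ^ (L0 + g)).+1 => n hn v a ha.
have n0 : (0 < n)%N by exact: leq_trans hn.
pose L := trunc_log 2 n.
have Ln : (2 ^ L <= n)%N by exact: trunc_logP.
have nL : (n < 2 ^ L.+1)%N by exact: trunc_log_ltn.
have LL0 : (L0 + g <= L)%N.
  by rewrite -ltnS -(@ltn_exp2l 2)//; apply: ltn_trans nL.
pose t := (L %/ g)%N; pose m := (2 ^ t)%N.
have t0 : (0 < t)%N by rewrite divn_gt0//; clear -LL0; lia.
have m1 : (1 < m)%N by rewrite -[1%N]/(2 ^ 0)%N ltn_exp2l.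
have mg : (m ^ g <= n)%N.
  by apply: leq_trans Ln; rewrite -expnM leq_exp2l// leq_trunc_div.
have nm : (n <= m ^ f)%N.
  apply: leq_trans (ltnW nL) _; rewrite -expnM leq_exp2l//.
  by have := ltn_ceil L g0; rewrite -/t /f; clear -t0 g0; nia.
have mm : (m + m <= n)%N.
  apply: leq_trans mg; apply: leq_trans (_ : m ^ 2 <= _)%N; last by rewrite leq_exp2l.
  by rewrite addnn -muln2 expnS expn1 leq_mul2l m1 orbT.
pose T2 := (ce * L.+1).+1.
have hp : ((ce * L + (ce + T0 + 3)) ^ g <= n)%N.
  by apply: leq_trans (HL0 L _) Ln; clear -LL0; lia.
have T2n : (T2.+1 <= n)%N.
  apply: leq_trans hp; apply: leq_trans (_ : (ce * L + (ce + T0 + 3)) ^ 1 <= _)%N.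
    by rewrite expn1 /T2; clear; nia.
  by rewrite leq_pexp2l//; clear; lia.
pose X := (n ^ ce)%N.
have E1 k : (0 < E k)%N.
  by rewrite /E; case: (_ - _)%N => [//|j] /=; rewrite /G; clear; lia.
have ES d : (d <= T0)%N -> E d = G (E d.+1).
  by move=> dT; rewrite /E subSS subSn.
pose N k := (n ^ E k)%N.
set p := expect _ _ in ha.
have lz : lazy [seq (mu, v i) | i <- enum 'I_n].
  by apply/allP => q /mapP[i _ ->] /=; lra.
have [|||||k|k|d dT||us [D [J [szT DN cardJ HJ]]]] :=
  @inverse_theorem_bounds R n v mu e (p ^+ 2) X T0 T2 t N (fun d => f * E d.+1)%N mu01 He.
- exact: sqr_ge0.
- rewrite /X natrX -exprM.
  have -> : p ^+ (2 * e) * n%:R ^+ ce = (p * n%:R ^+ c) ^+ (2 * e).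
    by rewrite exprMn -exprM; congr (_ * _ ^+ _); rewrite /ce; clear; lia.
  exact: exprn_ege1.
- exact: t0.
- rewrite -/m; apply: leq_ltn_trans (_ : (m ^ f) ^ ce < _)%N; first exact: expn_le.
  by rewrite -expnM ltn_exp2l.
- apply: leq_ltn_trans (_ : (2 ^ L.+1) ^ ce < _)%N; last by rewrite -expnM ltn_exp2l// mulnC.
  by apply: expn_le; exact: ltnW.
- rewrite /N leq_pexp2l//; have [kT|Tk] := leqP k T0; first by rewrite (ES k kT) /G; clear; nia.
  have z1 : (T0.+1 - k.+1 = 0)%N by clear -Tk; lia.
  have z2 : (T0.+1 - k = 0)%N by clear -Tk; lia.
  by rewrite /E z1 z2.
- by apply: leq_trans mm _; rewrite -[leqLHS]expn1 leq_pexp2l.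
- split; first by rewrite muln_gt0 E1 andbT /f; clear -g0; lia.
    by rewrite -/m expnM /N leq_exp2r.
  rewrite -/m /N (ES d dT) /G /X; set E' := E d.+1.
  have -> : ((ce * f + 2) * E' + 2 = ce * (f * E') + E' + 1 + E' + 1)%N by clear; lia.
  rewrite !expnD expn1 -expnM.
  by rewrite leq_mul// leq_mul2r leq_mul2l mm !orbT.
- exact: sqr_atom_le_prob0.
have i0 : 'I_n by exact: Ordinal n0.
have NK : (N 0%N <= n ^ K)%N by rewrite leq_pexp2l// /K; clear; lia.
have szK : (size us <= K)%N by apply: leq_trans szT _; rewrite /K; clear; lia.
exists [ffun h : 'I_K => nth i0 us h], D, (m * (T0 + T2 + 2))%N, J; split => //.
- by have /andP[-> /leq_trans ->] := DN.
- rewrite expnMn (expnS _ 1) expn1 leq_mul//; apply: leq_trans hp.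
  by rewrite leq_exp2r// /T2; clear; nia.
move=> j /HJ[k kN e1].
(* Padding to exactly [K] generators: positions beyond [us] get the coefficient 0, so the default
   [i0] contributes nothing. *)
exists [ffun h : 'I_K => if (h < size us)%N then k (nth i0 us h) else 0].
  by move=> h; rewrite ffunE; case: ifP => // _; exact: leq_trans (kN _) NK.
rewrite e1 /comb (big_nth i0) big_mkord.
rewrite (big_ord_widen K (fun h => v (nth i0 us h) *~ k (nth i0 us h)) szK).
rewrite big_mkcond; apply: eq_bigr => h _; rewrite !ffunE.
by case: ifP; rewrite ?mulr0z.
Qed.

End InverseLittlewoodOfford.

(** * The product law as a finite weighted sum *)

Section SignVectors.
Context {R : realType}.

Definition signval (k : 'I_3) : R := [:: 0; 1; -1]`_k.
Definition signwt (mu : R) (k : 'I_3) : R := [:: 1 - mu; mu / 2; mu / 2]`_k.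

Lemma signwt_ge0 mu k : 0 <= mu <= 1 -> 0 <= signwt mu k.
Proof. by move=> mu01; case: k => [[|[|[|]]]]//= ?; rewrite /signwt /=; lra. Qed.

Lemma sum_signwt (mu : R) (f : 'I_3 -> R) :
  \sum_k signwt mu k * f k =
  (1 - mu) * f 0 + mu / 2 * (f 1 + f (lift ord0 (lift ord0 ord0))).
Proof.
rewrite !big_ord_recl big_ord0 addr0 /signwt /= mulrDr.
by congr (_ * f _ + (_ * f _ + _ * f _)); apply/val_inj.
Qed.

Lemma sum_signwt1 (mu : R) : \sum_k signwt mu k = 1.
Proof. by rewrite !big_ord_recl big_ord0 /signwt /=; field. Qed.

Definition vecwt (mu : R) (T : finType) (w : {ffun T -> 'I_3}) : R :=
  \prod_s signwt mu (w s).

Lemma vecwt_ge0 mu (T : finType) (w : {ffun T -> 'I_3}) : 0 <= mu <= 1 -> 0 <= vecwt mu w.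
Proof. by move=> mu01; apply: prodr_ge0 => s _; exact: signwt_ge0. Qed.

Lemma sum_vecwt mu (T : finType) : \sum_(w : {ffun T -> 'I_3}) vecwt mu w = 1.
Proof.
rewrite -(bigA_distr_bigA (fun _ k => signwt mu k)) big1// => s _.
exact: sum_signwt1.
Qed.

Definition upd (T : finType) (w : {ffun T -> 'I_3}) s k : {ffun T -> 'I_3} :=
  [ffun t => if t == s then k else w t].

(* Exchanging [w s] with an independent copy preserves the joint law. *)
Lemma sum_vecwt_resample mu (T : finType) (s : T) (f : {ffun T -> 'I_3} -> R) :
  \sum_w vecwt mu w * f w =
  \sum_w vecwt mu w * \sum_k signwt mu k * f (upd w s k).
Proof.
transitivity (\sum_(p : {ffun T -> 'I_3} * 'I_3) vecwt mu p.1 * signwt mu p.2 * f p.1).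
  rewrite -(pair_bigA _ (fun w k => vecwt mu w * signwt mu k * f w)) /=.
  apply: eq_bigr => w _; under eq_bigr do rewrite mulrAC.
  by rewrite -mulr_sumr sum_signwt1 mulr1.
pose sw (p : {ffun T -> 'I_3} * 'I_3) := (upd p.1 s p.2, p.1 s).
have swK : involutive sw.
  move=> [w k]; rewrite /sw /=; congr (_, _); last by rewrite ffunE eqxx.
  by apply/ffunP => t; rewrite !ffunE; case: eqP => [->|].
rewrite (reindex_inj (inv_inj swK)) /=.
under [RHS]eq_bigr do rewrite mulr_sumr.
rewrite -[LHS](pair_bigA _ (fun w k => vecwt mu (upd w s k) * signwt mu (w s) * f (upd w s k))) /=.
apply: eq_bigr => w _; apply: eq_bigr => k _; rewrite mulrA; congr (_ * _).
rewrite /vecwt (bigD1 s)//= [in RHS](bigD1 s)//= ffunE eqxx.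
rewrite mulrAC [RHS]mulrAC mulrC [RHS]mulrC mulrA [RHS]mulrA mulrAC; congr (_ * _).
  by congr (_ * _); apply: eq_bigr => t /negbTE ts; rewrite ffunE ts.
Qed.

(** Resampling coordinate [i] makes it independent of the rest, so a step of the walk splits off
    without decomposing the product space. *)
Lemma sum_vecwt_expect mu (I : finType) (v : I -> R) (r : seq I) (f : R -> R) : uniq r ->
  \sum_w vecwt mu w * f (\sum_(i <- r) v i * signval (w i)) =
  expect [seq (mu, v i) | i <- r] f.
Proof.
elim: r f => [|i r IH] f /=.
  by move=> _; under eq_bigr do rewrite big_nil; rewrite -mulr_suml sum_vecwt mul1r.
move=> /andP[ir ur]; rewrite (sum_vecwt_resample mu i).
have E w k : \sum_(j <- i :: r) v j * signval (upd w i k j) =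
    v i * signval k + \sum_(j <- r) v j * signval (w j).
  rewrite big_cons ffunE eqxx; congr (_ + _); apply: eq_big_seq => j jr.
  by rewrite ffunE; case: eqP => // ji; rewrite -ji jr in ir.
under eq_bigr => w _ do under eq_bigr => k _ do rewrite E.
under eq_bigr => w _ do rewrite mulr_sumr.
rewrite exchange_big /=.
under eq_bigr => k _ do under eq_bigr => w _ do rewrite mulrCA.
under eq_bigr => k _ do rewrite -mulr_sumr (IH (fun z => f (v i * signval k + z)))//.
rewrite (sum_signwt mu (fun k => expect _ (fun z => f (v i * signval k + z)))).
rewrite /signval /= mulr0 mulr1 mulrN1; congr (_ * _ + _ * (_ + _)); apply: eq_expect => z.
  by rewrite add0r.
by rewrite addrC.
Qed.

Lemma pigeonhole_weight (T T' : finType) (W : T -> R) (G : pred T) (f : T -> T') (t0 : T') :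
  exists t, \sum_(y | G y) W y <= #|T'|%:R * \sum_(y | G y && (f y == t)) W y.
Proof.
apply/not_existsP => H.
have {}H t : #|T'|%:R * \sum_(y | G y && (f y == t)) W y < \sum_(y | G y) W y.
  by rewrite ltNge; apply/negP; exact: H.
have : \sum_t #|T'|%:R * \sum_(y | G y && (f y == t)) W y < \sum_(t : T') \sum_(y | G y) W y.
  apply: ltr_sum => //; apply/hasP; exists t0 => //; exact: mem_index_enum.
by rewrite -mulr_sumr -(partition_big f xpredT)//= sumr_const mulr_natl ltxx.
Qed.

End SignVectors.

(** * Rank reduction to a proper progression *)

Section ProperGap.
Context {R : realType}.

Lemma gap_set_card_le r (Q : sym_gap R r) B : (forall h, gap_bound Q h <= B)%N ->
  (gap_set Q #<= `I_((B.*2.+1) ^ r))%card.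
Proof.
move=> QB.
pose T : finType := {ffun 'I_r -> 'I_(B.*2.+1)}.
pose F (i : 'I_#|T|) := gap_val Q [ffun h => (enum_val i h : nat)%:Z - B%:Z].
have -> : ((B.*2.+1) ^ r = #|T|)%N by rewrite card_ffun !card_ord.
have sub : (gap_set Q `<=` range F)%classic.
  move=> _ [m mB <-]; exists (enum_rank [ffun h => inord `|(m h + B%:Z)%R|%N]) => //.
  congr gap_val; apply/ffunP => h; rewrite ffunE enum_rankK ffunE.
  have hb : (`|m h| <= B)%N := leq_trans (mB h) (QB h).
  by rewrite inordK; move: (m h) hb => k; clear; lia.
apply: card_le_trans (subset_card_le sub) _.
apply: card_le_trans (card_image_le _ _) _.
by rewrite (card_le_eqr card_II).
Qed.

(** Two representations of one value give a relation [d] with some $d_{h_0}\ne0$. Eliminating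
    $g_{h_0}$ leaves the generators $g_h/d_{h_0}$ with coefficients at most $4B^2\le B^4$, whence
    the exponent $4^r$. *)
Lemma proper_gap_exists r (g : 'I_r -> R) (B : nat) : (1 < B)%N ->
  exists (r' : nat) (Q : sym_gap R r'),
    [/\ (r' <= r)%N, gap_proper Q, forall h, (gap_bound Q h <= B ^ (4 ^ r))%N &
     forall m : 'I_r -> int, (forall h, `|m h| <= B)%N ->
       gap_set Q (\sum_(h < r) g h *~ m h)].
Proof.
elim: r g B => [|r IH] g B B1.
  exists 0%N, (SymGap g (fun=> B)); split => //.
  - by move=> m m' _ _ _; apply/ffunP; case.
  - move=> m mB; exists 0; first by move=> h; have := ltn_ord h; rewrite ltn0.
    by rewrite /gap_val !big_ord0.
pose Q0 := SymGap g (fun=> B).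
have valE (m : {ffun 'I_r.+1 -> int}) : gap_val Q0 m = \sum_(h < r.+1) g h *~ m h.
  by apply: eq_bigr => h _; rewrite mulrzl.
have [pr|npr] := pselect (gap_proper Q0).
  exists r.+1, Q0; split => // [h|m mB].
    by rewrite /= -[leqLHS]expn1 leq_pexp2l ?expn_gt0// ltnW.
  exists [ffun h => m h]; first by move=> h; rewrite ffunE; exact: mB.
  by rewrite valE; apply: eq_bigr => h _; rewrite ffunE.
have [d [h0 [dB dh0 d0]]] : exists (d : 'I_r.+1 -> int) h0,
    [/\ forall h, (`|d h| <= B + B)%N, d h0 != 0 & \sum_(h < r.+1) g h *~ d h = 0].
  move/existsNP: npr => [m /existsNP[m' /not_implyP[/set_mem mB /not_implyP[/set_mem mB']]]].
  move=> /not_implyP[e ne].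
  have /existsP[h0 hh0] : [exists h, m h != m' h].
    apply/existsPn => H; apply: ne; apply/ffunP => h; apply/eqP.
    by have := H h; rewrite negbK.
  exists (fun h => m h - m' h), h0; split => [h||].
  - by have := mB h; have := mB' h; rewrite /=; clear; lia.
  - by rewrite subr_eq0.
  - move: e; rewrite !valE => e; under eq_bigr do rewrite mulrzBr.
    by rewrite sumrB e subrr.
pose D : R := (d h0)%:~R.
have D0 : D != 0 by rewrite intr_eq0.
have B'1 : (1 < 4 * B ^ 2)%N by clear -B1; nia.
have [r' [Q [r'r prQ bQ memQ]]] := IH (fun h => g (lift h0 h) / D) (4 * B ^ 2)%N B'1.
exists r', Q; split => // [|h|m mB].
- exact: leq_trans r'r _.
- apply: leq_trans (bQ h) _; rewrite [(4 ^ r.+1)%N]expnS expnM; apply: expn_le.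
  by clear -B1; nia.
have key (x : R) (p q s : int) :
    x *~ p * D - x *~ q *~ s = (x / D) *~ (p * d h0 - s * q) * D.
  rewrite -[x *~ p]mulrzl -[x *~ q *~ s]mulrzA -[x *~ (q * s)]mulrzl.
  rewrite -[(x / D) *~ _]mulrzl intrB !intrM -/D.
  by field.
have -> : \sum_(h < r.+1) g h *~ m h =
   \sum_(h < r) (g (lift h0 h) / D) *~ (m (lift h0 h) * d h0 - m h0 * d (lift h0 h)).
  apply: (mulIf D0); rewrite !mulr_suml.
  rewrite (bigD1_ord h0)//=; move: d0; rewrite (bigD1_ord h0)//= => d0.
  have -> : g h0 *~ m h0 * D = (g h0 *~ d h0) *~ m h0.
    by rewrite /D mulrzr -!mulrzA mulrC.
  have -> : g h0 *~ d h0 = - \sum_(h < r) g (lift h0 h) *~ d (lift h0 h).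
    by apply/eqP; rewrite -addr_eq0 d0.
  rewrite mulNrz mulrz_suml -sumrN -big_split; apply: eq_bigr => h _ /=.
  by rewrite addrC; exact: key.
apply: memQ => h.
have h1 : (`|(m (lift h0 h) * d h0)%R| <= B * (B + B))%N by rewrite abszM leq_mul.
have h2 : (`|(- (m h0 * d (lift h0 h)))%R| <= B * (B + B))%N.
  by rewrite abszN abszM leq_mul.
by apply: leq_trans (absz_leD h1 h2) _; clear; nia.
Qed.

End ProperGap.

Lemma absz_sum_le (T : finType) (P : pred T) (F : T -> int) b :
  (forall h, `|F h| <= b)%N -> (`|(\sum_(h | P h) F h)%R| <= #|T| * b)%N.
Proof.
move=> Fb; rewrite -sum_nat_const big_mkcond /=.
elim/big_rec2: _ => // h x y _ yx; apply: absz_leD => //.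
by case: ifP.
Qed.

(** * From the linear to the bilinear inverse theorem *)

Section Bilinear.
Context {R : realType}.

Lemma le_powR_nat (Y n g : nat) (eps : R) : (0 < n)%N -> (0 < g)%N -> 2 <= g%:R * eps ->
  (Y ^ g <= n ^ 2)%N -> Y%:R <= n%:R `^ eps.
Proof.
move=> n0 g0 ge Yn.
rewrite -(@ler_pXn2r _ g)// ?nnegrE ?powR_ge0//.
rewrite -[(n%:R `^ eps) ^+ g]powR_mulrn ?powR_ge0// -powRrM [eps * _]mulrC.
apply: le_trans (_ : n%:R ^+ 2 <= _); first by rewrite -!natrX ler_nat.
by rewrite -powR_mulrn// ler_powR// ler1n.
Qed.

Lemma inverse_littlewood_offord (mu eps : R) (c : nat) : 0 < mu <= 1 -> 0 < eps ->
  exists K n0 : nat, forall n, (n0 <= n)%N -> forall (v : 'I_n -> R) (a : R),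
    1 <= expect [seq (mu, v i) | i <- enum 'I_n] (fun z => (z == a)%:R) * n%:R ^+ c ->
  exists (us : {ffun 'I_K -> 'I_n}) (D : nat) (J : {set 'I_n}),
    [/\ (0 < D <= n ^ K)%N, n%:R - n%:R `^ eps <= #|J|%:R &
     forall j, j \in J -> exists2 k : {ffun 'I_K -> int},
       (forall h, `|k h| <= n ^ K)%N & v j *+ D = \sum_(h < K) v (us h) *~ k h].
Proof.
move=> mu01 eps0.
have [g0 hg0] : exists g : nat, 2 / eps <= g%:R.
  by exists (Num.trunc (2 / eps)).+1; apply/ltW/truncnS_gt.
pose g := (g0 + 2)%N.
have ge : 2 <= g%:R * eps.
  rewrite -ler_pdivrMr//; apply: le_trans hg0 _; rewrite ler_nat /g; lia.
have [|K [n0 H]] := @inverse_littlewood_offord_nat R mu c g mu01.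
  by rewrite /g; lia.
exists K, n0.+1 => n hn v a /(H _ (ltnW hn))[us [D [Y [J [DK nJ Yg HJ]]]]].
exists us, D, J; split => //; rewrite lerBlDr.
apply: le_trans (_ : #|J|%:R + Y%:R <= _); first by rewrite -natrD ler_nat.
rewrite lerD2l; apply: le_powR_nat ge Yg; last by rewrite /g; lia.
by apply: leq_trans hn.
Qed.

Definition bilinear_conclusion (eps : R) n (K : nat) (A : 'M[R]_n) : Prop :=
  exists (I0 I : {set 'I_n}) (k : int),
    [/\ (#|I0| <= K)%N,
        n%:R - 3 * n%:R `^ eps <= #|I|%:R :> R,
        I :&: I0 = finset.set0,
        k != 0 /\ (`|k| <= n ^ K)%N &
        forall i, i \in I ->
          exists (r : nat) (Q : sym_gap R r) (J : {set 'I_n}) (kk : 'I_n -> int),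
            [/\ (r <= K)%N,
                gap_proper Q /\ (gap_set Q #<= `I_(n ^ K))%card,
                n%:R - n%:R `^ eps <= #|J|%:R :> R,
                (forall i0, i0 \in I0 -> (`|kk i0| <= n ^ K)%N) &
                forall j, j \in J ->
                  gap_set Q (\sum_(i0 in I0) (kk i0)%:~R * A i0 j + k%:~R * A i j)]].

(** Vectors [y] below the threshold contribute at most $n^{-c-1}$ to the mean, which is at most half
    of it. *)
Lemma large_fraction n mu c (q : {ffun 'I_n -> 'I_3} -> R) : 0 <= mu <= 1 -> (1 < n)%N ->
  (forall y, q y <= 1) ->
  1 <= (\sum_y vecwt mu y * q y) * n%:R ^+ c ->
  1 <= (\sum_(y | 1 <= q y * n%:R ^+ c.+1) vecwt mu y) * n%:R ^+ c.+1.
Proof.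
move=> mu01 n1 q1 h; set G := fun y => 1 <= q y * n%:R ^+ c.+1.
have N0 : 0 <= n%:R ^+ c.+1 :> R by rewrite exprn_ge0.
have : (\sum_y vecwt mu y * q y) * n%:R ^+ c.+1 <=
    (\sum_(y | G y) vecwt mu y) * n%:R ^+ c.+1 + 1.
  rewrite -[X in _ <= _ + X](@sum_vecwt R mu 'I_n) mulr_suml (bigID G) /=.
  apply: lerD.
    rewrite mulr_suml; apply: ler_sum => y _; apply: ler_wpM2r => //.
    by rewrite ler_piMr ?vecwt_ge0.
  rewrite [leRHS](bigID G) /=; apply: le_trans (_ : \sum_(y | ~~ G y) vecwt mu y <= _).
    apply: ler_sum => y; rewrite /G -ltNge => /ltW gy.
    by rewrite -mulrA ler_piMr ?vecwt_ge0.
  by rewrite lerDr; apply: sumr_ge0 => y _; exact: vecwt_ge0.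
have : 2 <= (\sum_y vecwt mu y * q y) * n%:R ^+ c.+1.
  rewrite exprSr mulrA; apply: le_trans (_ : 1 * n%:R <= _).
    by rewrite mul1r (ler_nat _ 2).
  by rewrite ler_wpM2r.
lra.
Qed.

(** Double counting of the pairs with $i\notin J_y$: each [y] misses at most [B] indices, and a bad
    index is missed by at least half the weight. *)
Lemma bad_index_count n (G : pred {ffun 'I_n -> 'I_3}) (W : {ffun 'I_n -> 'I_3} -> R)
    (J : {ffun 'I_n -> 'I_3} -> {set 'I_n}) (B : R) :
  (forall y, 0 <= W y) -> 0 < \sum_(y | G y) W y ->
  (forall y, G y -> n%:R - B <= #|J y|%:R) ->
  #|[set i | 2 * \sum_(y | G y && (i \in J y)) W y < \sum_(y | G y) W y]|%:R <= 2 * B.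
Proof.
move=> W0 g0 hJ; set g := \sum_(y | G y) W y in g0 *; set Bd := [set i | _].
have : \sum_(i in Bd) g / 2 <= \sum_(i < n) \sum_(y | G y && (i \notin J y)) W y.
  rewrite big_mkcond /=; apply: ler_sum => i _; case: ifP.
    have : g = \sum_(y | G y && (i \in J y)) W y + \sum_(y | G y && (i \notin J y)) W y.
      by rewrite /g (bigID (fun y => i \in J y)).
    by rewrite inE; lra.
  by move=> _; apply: sumr_ge0.
have -> : \sum_(i < n) \sum_(y | G y && (i \notin J y)) W y =
    \sum_(y | G y) W y * #|~: J y|%:R.
  under eq_bigr do rewrite big_mkcondr /=.
  rewrite exchange_big /=; apply: eq_bigr => y _.
  rewrite -big_mkcond /= sumr_const mulr_natr; congr (_ *+ _).
  by apply: eq_card => i; rewrite !inE.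
have : \sum_(y | G y) W y * #|~: J y|%:R <= \sum_(y | G y) W y * B.
  apply: ler_sum => y Gy; apply: ler_wpM2l => //.
  have := hJ y Gy; rewrite -[in n%:R](card_ord n) -(cardsC (J y)) natrD; lra.
rewrite -mulr_suml -/g sumr_const => h1 h2; have := le_trans h2 h1.
move=> h; suff : g * (2^-1 * #|Bd|%:R) <= g * B by rewrite ler_pM2l//; lra.
by move: h; rewrite -[_ *+ #|_|]mulr_natr mulrA.
Qed.

Lemma proper_gap_cover K (g : 'I_K -> R) n : (1 < n)%N ->
  let E := (K.+1 * 4 ^ K)%N in
  exists (r : nat) (Q : sym_gap R r),
    [/\ (r <= K)%N, gap_proper Q, (gap_set Q #<= `I_(n ^ (E.+2 * K)))%card &
     forall m : 'I_K -> int, (forall h, `|m h| <= n ^ K)%N ->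
       gap_set Q (\sum_(h < K) g h *~ m h)].
Proof.
(* The exponent [K.+1] keeps the side length above 1 even when [K = 0]. *)
move=> n1 E; have B1 : (1 < n ^ K.+1)%N by rewrite -(expn0 n) ltn_exp2l.
have [r [Q [rK prQ bQ memQ]]] := proper_gap_exists g B1.
exists r, Q; split => //.
- apply: card_le_trans (gap_set_card_le bQ) _; rewrite card_le_II -expnM -/E expnM.
  apply: leq_trans (_ : (n ^ E.+2) ^ r <= _)%N.
    apply: expn_le; rewrite 2!expnS mulnA; have : (0 < n ^ E)%N by rewrite expn_gt0 ltnW.
    move: (n ^ E)%N => s s0; apply: leq_trans (_ : 4 * s <= _)%N; first by clear -s0; lia.
    by rewrite leq_mul2r (leq_mul n1 n1) orbT.
  by rewrite leq_pexp2l// expn_gt0 ltnW.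
- move=> m mK; apply: memQ => h; apply: leq_trans (mK h) _.
  by rewrite leq_pexp2l// ltnW.
Qed.

Lemma bilinear_inverse (mu eps : R) (c : nat) : 0 < mu <= 1 -> 0 < eps ->
  exists K n0 : nat, forall n, (n0 <= n)%N -> forall (A : 'M[R]_n) (a : R),
    1 <= (\sum_(y : {ffun 'I_n -> 'I_3}) vecwt mu y *
       expect [seq (mu, \sum_j A i j * signval (y j)) | i <- enum 'I_n]
         (fun z => (z == a)%:R)) * n%:R ^+ c ->
    bilinear_conclusion eps K A.
Proof.
move=> mu01 eps0; have mu01' : 0 <= mu <= 1 by lra.
have [K1 [n1 LIN1]] := inverse_littlewood_offord c.+1 mu01 eps0.
(* Polynomial losses: $n^{K_1}$ choices of generators and at most $n^{K_1+1}$ denominators; then a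
   factor 2 for fixing [i], and $(2n^{K_1}+1)^{K_1}$ coefficient vectors. *)
pose c2 := (c.+1 + (K1 + K1.+1))%N; pose c3 := (c2 + 1 + K1.+2 * K1)%N.
have [K3 [n3 LIN3]] := inverse_littlewood_offord c3 mu01 eps0.
pose E := (K3.+1 * 4 ^ K3)%N; pose K := (K1.+1 + K3 + E.+2 * K3)%N.
have [g0 hg0] : exists g : nat, 2 / eps <= g%:R.
  by exists (Num.trunc (2 / eps)).+1; apply/ltW/truncnS_gt.
(* The term [K1 ^ g0.+1] forces $|I_0|\le n^\varepsilon$; the bad indices account for the other
   $2n^\varepsilon$. *)
exists K, (n1 + n3 + K1 + K1 ^ g0.+1 + 2)%N => n hn A a ha.
have n1n : (n1 <= n)%N by clear -hn; lia.
have n3n : (n3 <= n)%N by clear -hn; lia.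
have n2 : (1 < n)%N by clear -hn; lia.
have K1n : (K1 <= n)%N by clear -hn; lia.
have K1g : (K1 ^ g0.+1 <= n ^ 2)%N.
  by apply: leq_trans (leq_pmulr _ _); [clear -hn; lia | clear -n2; lia].
have n0 : (0 < n)%N by exact: ltnW.
have nR0 : 0 < n%:R :> R by rewrite ltr0n.
set B := n%:R `^ eps.
have K1B : K1%:R <= B.
  apply: le_powR_nat K1g => //; rewrite -ler_pdivrMr//; apply: le_trans hg0 _.
  by rewrite ler_nat.
pose b (y : {ffun 'I_n -> 'I_3}) i : R := \sum_j A i j * signval (y j).
pose q y := expect [seq (mu, b y i) | i <- enum 'I_n] (fun z => (z == a)%:R).
have lz (v : 'I_n -> R) : lazy [seq (mu, v i) | i <- enum 'I_n].
  by apply/allP => p /mapP[i _ ->].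
have q1 y : q y <= 1 by apply: expect_le_cst => // z; case: eqP.
pose Gd y := 1 <= q y * n%:R ^+ c.+1.
have hG := large_fraction mu01' n2 q1 ha; rewrite -/Gd in hG.
have H y : exists p : {ffun 'I_K1 -> 'I_n} * 'I_(n ^ K1).+1 * {set 'I_n}, Gd y ->
    [/\ (0 < p.1.2)%N, n%:R - B <= #|p.2|%:R &
     forall i, i \in p.2 -> exists2 k : {ffun 'I_K1 -> int},
       (forall h, `|k h| <= n ^ K1)%N & b y i *+ p.1.2 = \sum_(h < K1) b y (p.1.1 h) *~ k h].
  case: (boolP (Gd y)) => [Gy|_]; last by exists ([ffun => Ordinal n0], ord0, finset.set0).
  have [us [D [J [/andP[D0 DK] hJ HJ]]]] := LIN1 n n1n (b y) a Gy.
  by exists (us, Ordinal (DK : (D < (n ^ K1).+1)%N), J).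
have {H} [dt hdt] := choice H.
have W0 (y : {ffun 'I_n -> 'I_3}) : 0 <= vecwt mu y :> R by exact: vecwt_ge0.
have [[us D] hus] :=
  pigeonhole_weight (@vecwt R mu 'I_n) Gd (fun y => (dt y).1) ([ffun => Ordinal n0], ord0).
pose G2 y := Gd y && ((dt y).1 == (us, D)).
pose gw : R := \sum_(y | G2 y) vecwt mu y; rewrite -/gw in hus.
have hgw : 1 <= gw * n%:R ^+ c2.
  apply: le_trans hG _; apply: le_trans (ler_wpM2r _ hus) _; first by rewrite exprn_ge0// ltW.
  rewrite [leLHS]mulrAC [leLHS]mulrC ler_wpM2l//; first by apply: sumr_ge0.
  rewrite card_prod card_ffun !card_ord /c2 exprD [leRHS]mulrC ler_wpM2r ?exprn_ge0 ?(ltW nR0)//.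
  rewrite -natrX ler_nat expnD leq_mul// [(n ^ K1.+1)%N]expnS.
  have : (0 < n ^ K1)%N by rewrite expn_gt0 n0.
  move: (n ^ K1)%N => s s0; apply: leq_trans (_ : 2 * s <= _)%N; first by clear -s0; lia.
  by rewrite leq_mul2r n2 orbT.
have gw0 : 0 < gw.
  rewrite -(pmulr_lgt0 _ (exprn_gt0 c2 nR0)); exact: lt_le_trans hgw.
have G2P y : G2 y -> [/\ (0 < D)%N, n%:R - B <= #|(dt y).2|%:R &
     forall i, i \in (dt y).2 -> exists2 k : {ffun 'I_K1 -> int},
       (forall h, `|k h| <= n ^ K1)%N & b y i *+ D = \sum_(h < K1) b y (us h) *~ k h].
  by move=> /andP[/hdt + /eqP e]; rewrite e.
have D0 : (0 < D)%N.
  case: (pickP G2) => [y /G2P[]//|none].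
  by move: gw0; rewrite /gw big_pred0 ?ltxx.
pose I0 := [set us h | h in 'I_K1].
pose Bd := [set i | 2 * \sum_(y | G2 y && (i \in (dt y).2)) vecwt mu y < gw].
have cardBd : #|Bd|%:R <= 2 * B.
  by apply: (@bad_index_count _ G2 (@vecwt R mu 'I_n) (fun y => (dt y).2)) => // y /G2P[].
have cardI0 : (#|I0| <= K1)%N.
  by apply: leq_trans (leq_imset_card _ _) _; rewrite card_ord.
have DK : (D <= n ^ K1)%N by rewrite -ltnS.
have nK k : (k <= K)%N -> (n ^ k <= n ^ K)%N by move=> ?; rewrite leq_pexp2l.
exists I0, (~: (I0 :|: Bd)), D%:Z; split.
- by apply: leq_trans cardI0 _; rewrite /K; clear; lia.
- have := cardsC (I0 :|: Bd); rewrite card_ord => cU.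
  have : (#|I0 :|: Bd| <= K1 + #|Bd|)%N.
    by apply: leq_trans (leq_card_setU _ _) _; rewrite leq_add2r.
  rewrite -(ler_nat R) natrD => h.
  have : n%:R = #|I0 :|: Bd|%:R + #|~: (I0 :|: Bd)|%:R :> R by rewrite -natrD cU.
  rewrite -/B; clear -h K1B cardBd; lra.
- by apply/setP => i; rewrite !inE; case: (i \in I0); rewrite ?andbF.
- split; first by clear -D0; lia.
  by apply: leq_trans DK (nK _ _); rewrite /K; clear; lia.
move=> i; rewrite !inE negb_or -leNgt => /andP[_ hi].
pose G3 y := G2 y && (i \in (dt y).2).
have Hk y : exists k : {ffun 'I_K1 -> int}, G3 y ->
    (forall h, `|k h| <= n ^ K1)%N /\ b y i *+ D = \sum_(h < K1) b y (us h) *~ k h.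
  case: (boolP (G3 y)) => [/andP[/G2P[_ _ HJ] /HJ[k k1 k2]]|_]; first by exists k.
  by exists 0.
have {Hk} [kf hkf] := choice Hk.
pose M := (n ^ K1)%N.
(* Shifted by [M], coefficients in $[-M,M]$ become ordinals; [inord] is faithful on this range,
   which [G3] guarantees. *)
pose enc y : {ffun 'I_K1 -> 'I_(M.*2.+1)} := [ffun h => inord `|(kf y h + M%:Z)%R|%N].
have [t ht] := pigeonhole_weight (@vecwt R mu 'I_n) G3 enc [ffun => ord0].
pose k0 h : int := (t h)%:Z - M%:Z.
have k0M h : (`|k0 h| <= M)%N.
  by rewrite /k0; have := ltn_ord (t h); move: (nat_of_ord _) => s; clear; lia.
(* On the chosen class of [y] this vector is orthogonal to the signs of [y], so its own walk has a
   large atom at 0. *)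
pose u j : R := A i j *+ D - \sum_(h < K1) A (us h) j *~ k0 h.
have hu y : G3 y && (enc y == t) -> \sum_j u j * signval (y j) = 0.
  move=> /andP[/hkf[kM e] /eqP et].
  have kE h : kf y h = k0 h.
    rewrite /k0 -et ffunE; have := kM h; rewrite -/M; move: (kf y h) => s hs.
    by rewrite inordK; clear -hs; lia.
  rewrite /u; under eq_bigr do rewrite mulrBl.
  rewrite sumrB; apply/eqP; rewrite subr_eq0; apply/eqP.
  have -> : \sum_j A i j *+ D * signval (y j) = b y i *+ D.
    by rewrite /b -sumrMnl; apply: eq_bigr => j _; rewrite mulrnAl.
  rewrite e /b; under eq_bigr do rewrite mulrz_suml.
  rewrite exchange_big /=; apply: eq_bigr => j _; rewrite mulr_suml.
  by apply: eq_bigr => h _; rewrite kE mulrzAl.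
have hu1 : 1 <= expect [seq (mu, u j) | j <- enum 'I_n] (fun z => (z == 0)%:R) * n%:R ^+ c3.
  set p := expect _ _.
  pose g3 : R := \sum_(y | G3 y && (enc y == t)) vecwt mu y; rewrite -/g3 in ht.
  have pg3 : g3 <= p.
    rewrite /p -sum_vecwt_expect ?enum_uniq// /g3 [leRHS](bigID (fun y => G3 y && (enc y == t))) /=.
    apply: le_trans (_ : g3 + 0 <= _); first by rewrite addr0.
    apply: lerD; last by apply: sumr_ge0 => y _; apply: mulr_ge0.
    rewrite le_eqVlt; apply/orP; left; apply/eqP; apply: eq_bigr => y /hu e.
    by rewrite big_enum /= e eqxx mulr1.
  have g30 : 0 <= g3 by apply: sumr_ge0.
  apply: le_trans hgw _; apply: le_trans (ler_wpM2r _ hi) _; first by rewrite exprn_ge0// ltW.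
  apply: le_trans (_ : 2 * (#|{ffun 'I_K1 -> 'I_(M.*2.+1)}|%:R * g3) * n%:R ^+ c2 <= _).
    by rewrite ler_wpM2r ?exprn_ge0 ?(ltW nR0)// ler_wpM2l.
  apply: le_trans (_ : g3 * n%:R ^+ c3 <= _); last by rewrite ler_wpM2r ?exprn_ge0 ?(ltW nR0).
  rewrite mulrA [2 * _ * g3]mulrC -mulrA ler_wpM2l// /c3.
  rewrite -addnA [leRHS]exprD [leRHS]mulrC ler_wpM2r ?exprn_ge0 ?(ltW nR0)// exprD expr1.
  rewrite -natrX -!natrM ler_nat card_ffun !card_ord leq_mul// expnM; apply: expn_le.
  have : (0 < M)%N by rewrite expn_gt0 n0.
  rewrite 2!expnS mulnA -/M; move: (M) => s s0.
  apply: leq_trans (_ : 4 * s <= _)%N; first by clear -s0; lia.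
  by rewrite leq_mul2r (leq_mul n2 n2) orbT.
have [us3 [D3 [J3 [/andP[D30 D3K] hJ3 HJ3]]]] := LIN3 n n3n u 0 hu1.
(* Dividing the generators by [D3] absorbs the denominator. *)
have [r [Q [rK prQ cQ memQ]]] := proper_gap_cover (fun h => u (us3 h) / D3%:R) n2.
(* Several [h] may name the same index [us h]; their coefficients are added up. *)
exists r, Q, J3, (fun i0 => - \sum_(h < K1 | us h == i0) k0 h); split => //.
- by apply: leq_trans rK _; rewrite /K; clear; lia.
- split => //; apply: card_le_trans cQ _; rewrite card_le_II; apply: nK.
  by rewrite /K -/E; clear; lia.
- move=> i0 _; rewrite abszN; apply: leq_trans (absz_sum_le _ k0M) _.
  rewrite card_ord; apply: leq_trans (_ : n * n ^ K1 <= _)%N; first by rewrite leq_mul2r K1n orbT.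
  by rewrite -expnS; apply: nK; rewrite /K; clear; lia.
move=> j /HJ3[k3 k3K e3].
have -> : \sum_(i0 in I0) (- \sum_(h < K1 | us h == i0) k0 h)%:~R * A i0 j + D%:Z%:~R * A i j = u j.
  rewrite /u addrC; congr (_ + _); first by rewrite mulr_natl.
  rewrite (partition_big us (mem I0)) /=; last by move=> h _; exact: imset_f.
  rewrite -sumrN; apply: eq_bigr => i0 _; rewrite intrN mulNr; congr (- _).
  rewrite rmorph_sum mulr_suml; apply: eq_bigr => h /eqP ->.
  by rewrite mulrzl.
have -> : u j = \sum_(h < K3) (u (us3 h) / D3%:R) *~ k3 h.
  have D3R : D3%:R != 0 :> R by rewrite pnatr_eq0 -lt0n.
  apply: (mulIf D3R); rewrite mulr_natr e3 mulr_suml; apply: eq_bigr => h _.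
  by rewrite -mulrzAl divfK.
exact: memQ.
Qed.

End Bilinear.

Local Open Scope classical_set_scope.
Local Open Scope ring_scope.

(** * Passage from random variables to finite sums *)

Section FiniteLaw.
Context {R : realType} {d : measure_display} {T : measurableType d}.
Variable P : probability T R.

Lemma measure_bigsetU_le (I : Type) (r : seq I) (Q : pred I) (F : I -> set T) :
  (forall i, Q i -> measurable (F i)) ->
  (P (\big[setU/set0]_(i <- r | Q i) F i) <= \sum_(i <- r | Q i) P (F i))%E.
Proof.
move=> mF; elim: r => [|i r IH]; first by rewrite !big_nil measure0.
rewrite !big_cons; case: ifP => Qi //.
apply: le_trans (measureU2 _ _ _) _; [exact: mF|exact: bigsetU_measurable|].
by rewrite leeD2l.
Qed.

Definition off_support (X : T -> R) : set T := [set t | [/\ X t <> 0, X t <> 1 & X t <> -1]].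

Lemma off_support_negligible mu (X : {RV P >-> R}) : is_eta mu X ->
  measurable (off_support X) /\ P (off_support X) = 0%E.
Proof.
move=> [h1 hm h0].
have mX a : measurable [set t | X t = a].
  by rewrite -[X in measurable X]setTI; exact: (measurable_funPT X _ [set a]).
have E : off_support X = ~` ([set t | X t = 0] `|` ([set t | X t = 1] `|` [set t | X t = -1])).
  apply/seteqP; split => t /=; first by move=> [] ? ? ? [|[]].
  by move=> H; split => ?; apply: H; [left|right; left|right; right].
have mU : measurable ([set t | X t = 0] `|` ([set t | X t = 1] `|` [set t | X t = -1])).
  by apply: measurableU => //; apply: measurableU.
rewrite E; split; first exact: measurableC.
have d1 : [set t | X t = 1] `&` [set t | X t = -1] = set0.
  by apply/seteqP; split => t //= [->]; lra.
have d0 : [set t | X t = 0] `&` ([set t | X t = 1] `|` [set t | X t = -1]) = set0.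
  by apply/seteqP; split => t //= [-> []]; lra.
have e1 : P ([set t | X t = 1] `|` [set t | X t = -1]) = (mu / 2 + mu / 2)%:E.
  exact: etrans (measureU P (mX _) (mX _) d1) (congr2 (fun a b => (a + b)%E) h1 hm).
have e0 : P ([set t | X t = 0] `|` ([set t | X t = 1] `|` [set t | X t = -1])) =
    (1 - mu + (mu / 2 + mu / 2))%:E.
  exact: etrans (measureU P (mX _) (measurableU _ _ (mX _) (mX _)) d0)
    (congr2 (fun a b => (a + b)%E) h0 e1).
by rewrite probability_setC// e0 -EFinB; congr EFin; field.
Qed.

Lemma mem_bigsetU (I : finType) (Q : pred I) (F : I -> set T) i t :
  Q i -> F i t -> (\big[setU/set0]_(j | Q j) F j) t.
Proof. by move=> Qi Ft; rewrite (bigD1 i)//=; left. Qed.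

(** Outside a null set all variables take values 0, 1, -1, so the event is covered by finitely many
    atoms. Independence gives their masses, and a union bound concludes. *)
Lemma prob_event_le (S : finType) (mu : R) (X : S -> {RV P >-> R})
    (F : (S -> R) -> Prop) :
  (forall s, is_eta mu (X s)) -> mutually_independent X ->
  (forall f g, f =1 g -> F f -> F g) ->
  measurable [set t | F (fun s => X s t)] ->
  (P [set t | F (fun s => X s t)] <=
   (\sum_(w : {ffun S -> 'I_3}) vecwt mu w * `[< F (fun s => signval (w s)) >]%:R)%:E)%E.
Proof.
move=> Xeta ind Fext mF.
have mX s a : measurable (X s @^-1` [set a]).
  by rewrite -[X in measurable X]setTI; exact: (measurable_funPT (X s) _ [set a]).
pose N := \big[setU/set0]_(s : S) off_support (X s).
have mN : measurable N.
  by apply: bigsetU_measurable => s _; have [] := off_support_negligible (Xeta s).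
have PN : (P N <= 0)%E.
  apply: le_trans (measure_bigsetU_le _ (fun s _ => (off_support_negligible (Xeta s)).1)) _.
  by rewrite big1// => s _; exact: (off_support_negligible (Xeta s)).2.
pose atom (w : {ffun S -> 'I_3}) : set T :=
  \bigcap_(s in [set` [set: S]%SET]) (X s @^-1` [set signval (w s)]).
have matom w : measurable (atom w).
  by apply: fin_bigcap_measurable => // s _; exact: mX.
have Patom w : P (atom w) = (vecwt mu w)%:E.
  rewrite /atom (ind _ (fun s => [set signval (w s)])); last by move=> s; exact: measurable_set1.
  rewrite /vecwt -prodEFin; apply: eq_big => [s|s _]; first by rewrite inE.
  have [h1 hm h0] := Xeta s.
  by case: (w s) => [[|[|[|k]]] hk]; rewrite /signval /signwt //=.
pose U := \big[setU/set0]_(w : {ffun S -> 'I_3} | `[< F (fun s => signval (w s)) >]) atom w.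
have mU : measurable U by apply: bigsetU_measurable.
have sub : [set t | F (fun s => X s t)] `<=` N `|` U.
  move=> t /= Ft; have [Nt|Nt] := pselect (N t); first by left.
  right; have Xt s : exists k : 'I_3, X s t = signval k.
    apply: contrapT => H; apply: Nt; apply: (@mem_bigsetU _ _ _ s) => //.
    split => e; apply: H.
    - by exists (@Ordinal 3 0 isT).
    - by exists (@Ordinal 3 1 isT).
    - by exists (@Ordinal 3 2 isT).
  have [w hw] := choice Xt.
  apply: (@mem_bigsetU _ _ _ [ffun s => w s]).
    apply/asboolP; apply: Fext Ft => s; by rewrite ffunE.
  by move=> s _ /=; rewrite ffunE hw.
apply: le_trans (le_measure P _ _ sub) _; rewrite ?inE//.
  exact: measurableU.
apply: le_trans (measureU2 _ mN mU) _.
rewrite -[leRHS]add0e; apply: leeD => //.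
apply: le_trans (measure_bigsetU_le _ (fun w _ => matom w)) _.
rewrite (eq_bigr (fun w => (vecwt mu w)%:E)) // sumEFin lee_fin big_mkcond /=.
apply: ler_sum => w _; case: asboolP => _; rewrite ?mulr1 ?mulr0//.
Qed.

End FiniteLaw.

Lemma sum_vecwt_join (R : realType) (mu : R) n
    (G : {ffun 'I_n -> 'I_3} -> {ffun 'I_n -> 'I_3} -> R) :
  \sum_(w : {ffun 'I_n + 'I_n -> 'I_3})
     vecwt mu w * G [ffun i => w (inl i)] [ffun j => w (inr j)] =
  \sum_y vecwt mu y * \sum_x vecwt mu x * G x y.
Proof.
pose join (p : {ffun 'I_n -> 'I_3} * {ffun 'I_n -> 'I_3}) : {ffun 'I_n + 'I_n -> 'I_3} :=
  [ffun s => match s with inl i => p.2 i | inr j => p.1 j end].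
pose split (w : {ffun 'I_n + 'I_n -> 'I_3}) :=
  ([ffun j => w (inr j)] : {ffun 'I_n -> 'I_3}, [ffun i => w (inl i)] : {ffun 'I_n -> 'I_3}).
have joinK : cancel join split.
  by move=> [y x]; congr (_, _); apply/ffunP => i; rewrite !ffunE.
have splitK : cancel split join.
  by move=> w; apply/ffunP => -[i|i]; rewrite !ffunE.
rewrite (reindex join) /=; last by exists split => p _; [exact: joinK|exact: splitK].
under [RHS]eq_bigr do rewrite mulr_sumr.
rewrite pair_bigA /=; apply: eq_bigr => -[y x] _ /=.
have -> : [ffun i => join (y, x) (inl i)] = x by apply/ffunP => i; rewrite !ffunE.
have -> : [ffun j => join (y, x) (inr j)] = y by apply/ffunP => i; rewrite !ffunE.
rewrite mulrA; congr (_ * _); rewrite /vecwt big_sumType /= mulrC.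
by congr (_ * _); apply: eq_bigr => i _; rewrite ffunE.
Qed.

(** For fixed [y] the form is a linear walk in [x] with coefficients $\sum_j a_{ij}y_j$. *)
Lemma prob_bilinear_le (R : realType) (mu : R) (d : measure_display) (T : measurableType d)
    (P : probability T R) n (A : 'M[R]_n) (x y : 'I_n -> {RV P >-> R}) (a : R) :
  (forall i, is_eta mu (x i)) -> (forall j, is_eta mu (y j)) ->
  mutually_independent (join_family x y) ->
  (P [set t | (\sum_(i < n) \sum_(j < n) A i j * x i t * y j t = a)%R] <=
   (\sum_(w : {ffun 'I_n -> 'I_3}) vecwt mu w *
      expect [seq (mu, \sum_j A i j * signval (w j)) | i <- enum 'I_n]
        (fun z => (z == a)%:R))%:E)%E.
Proof.
move=> hx hy ind.
pose F (f : 'I_n + 'I_n -> R) := \sum_i \sum_j A i j * f (inl i) * f (inr j) = a.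
have heta s : is_eta mu (join_family x y s) by case: s.
have Fext f g : f =1 g -> F f -> F g.
  move=> fg; rewrite /F => <-; apply: eq_bigr => i _; apply: eq_bigr => j _.
  by rewrite !fg.
have mF : measurable [set t | F (fun s => join_family x y s t)].
  have mh : measurable_fun setT (fun t => \sum_i \sum_j A i j * x i t * y j t).
    apply: measurable_sum => i; apply: measurable_sum => j.
    apply: measurable_realfun.measurable_funM; last exact: measurable_funPT.
    apply: measurable_realfun.measurable_funM; last exact: measurable_funPT.
    exact: measurable_cst.
  by rewrite -[X in measurable X]setTI; exact: (mh measurableT _ (measurable_set1 a)).
apply: le_trans (prob_event_le heta ind Fext mF) _; rewrite lee_fin.
pose G (u w : {ffun 'I_n -> 'I_3}) : R :=
  (\sum_(i <- enum 'I_n) (\sum_j A i j * signval (w j)) * signval (u i) == a)%:R.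
have -> : \sum_(w : {ffun 'I_n + 'I_n -> 'I_3})
     vecwt mu w * `[< F (fun s => signval (w s)) >]%:R =
  \sum_(w : {ffun 'I_n + 'I_n -> 'I_3})
     vecwt mu w * G [ffun i => w (inl i)] [ffun j => w (inr j)].
  apply: eq_bigr => w _; congr (_ * _%:R); congr nat_of_bool.
  have -> : \sum_(i <- enum 'I_n) (\sum_j A i j * signval ([ffun j => w (inr j)] j)) *
      signval ([ffun i => w (inl i)] i) =
    \sum_i \sum_j A i j * signval (w (inl i)) * signval (w (inr j)).
    rewrite big_enum; apply: eq_bigr => i _; rewrite mulr_suml; apply: eq_bigr => j _.
    by rewrite !ffunE mulrAC.
  by apply/asboolP/eqP.
rewrite sum_vecwt_join; apply: ler_sum => w _.
by rewrite /G (sum_vecwt_expect mu _ (fun z => (z == a)%:R)) ?enum_uniq.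
Qed.

Unset Implicit Arguments.

Theorem theorem7p3 (R : realType) (eps mu C : R) :
  0 < eps <= 1 -> 0 < mu <= 1 -> 0 < C ->
  exists K n0 : nat, forall n : nat, (n0 <= n)%N ->
  forall (A : 'M[R]_n) (d : measure_display) (T : measurableType d)
    (P : probability T R) (x y : 'I_n -> {RV P >-> R}),
    (forall i, is_eta mu (x i)) -> (forall j, is_eta mu (y j)) ->
    mutually_independent (join_family x y) ->
    ((n%:R `^ (- C))%:E <= rho_b A x y)%E ->
    exists (I0 I : {set 'I_n}) (k : int),
      [/\ (#|I0| <= K)%N,
          n%:R - 3 * n%:R `^ eps <= #|I|%:R :> R,
          I :&: I0 = finset.set0,
          k != 0 /\ (`|k| <= n ^ K)%N &
          forall i, i \in I ->
            exists (r : nat) (Q : sym_gap R r) (J : {set 'I_n})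
                   (kk : 'I_n -> int),
              [/\ (r <= K)%N,
                  gap_proper Q /\ (gap_set Q #<= `I_(n ^ K))%card,
                  n%:R - n%:R `^ eps <= #|J|%:R :> R,
                  (forall i0, i0 \in I0 -> (`|kk i0| <= n ^ K)%N) &
                  forall j, j \in J ->
                    gap_set Q (\sum_(i0 in I0) (kk i0)%:~R * A i0 j
                               + k%:~R * A i j)]].
Proof.
(* An integer strictly above [C]: the supremum then strictly exceeds $n^{-c}$, so some value [a] has
   an atom that large. *)
move=> /andP[eps0 _] mu01 C0; pose c := (Num.trunc C).+1.
have Cc : C < c%:R by exact: truncnS_gt.
have [K [n0 H]] := bilinear_inverse c mu01 eps0.
exists K, (n0 + 2)%N => n hn A d T P x y hx hy ind hrho.
have n1 : (1 < n)%N by clear -hn; lia.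
have nR1 : 1 < n%:R :> R by rewrite ltr1n.
have : ((n%:R `^ (- c%:R))%:E < rho_b A x y)%E.
  apply: lt_le_trans hrho; rewrite lte_fin /powR gt_eqF ?(lt_trans _ nR1)//.
  by rewrite ltr_expR ltr_pM2r ?ln_gt0// ltrN2.
move=> /ereal_sup_gt[_ [a _ <-] ha].
apply: (H n _ A a); first by clear -hn; lia.
have := lt_le_trans ha (prob_bilinear_le A a hx hy ind); rewrite lte_fin => /ltW.
rewrite powRN powR_mulrn// => h.
have nc0 : 0 < n%:R ^+ c :> R by rewrite exprn_gt0// (lt_trans _ nR1).
by rewrite -(ler_pdivrMr _ _ nc0) mul1r.
Qed.
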